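(* Let $F_0$ be a continuous distribution function on $\mathbb{R}$, and let $X_1,X_2,\ldots$ be i.i.d. real random variables with common distribution function $F_0$. For integers $1\le k<n$ let $X_{(1)}\le\ldots\le X_{(n)}$ be the order statistics of $X_1,\ldots,X_n$, and put \[ R_{k,n}=\ln\bigl(1-F_0(X_{(n-k)})\bigr)-\frac1k\sum_{i=n-k+1}^{n}\ln\bigl(1-F_0(X_{(i)})\bigr). \] Then, as $k,n\to\infty$ with $k<n$, $\sqrt{k}\,(R_{k,n}-1)$ converges in distribution to a standard normal random variable $\xi\sim N(0,1)$.
   Context: The statistic $R_{k,n}$ is well defined almost surely, since $F_0(X_i)<1$ almost surely. The joint limit ''$k,n\to\infty$ with $k<n$'' means the convergence holds along every sequence of pairs $(k,n)$ of integers with $1\le k<n$ and both $k\to\infty$ and $n\to\infty$. *)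

(* Defs.v *)
From HB Require Import structures.
From mathcomp Require Import all_boot all_order all_algebra finmap.
From mathcomp Require Import all_classical all_reals all_analysis measurable_realfun.
Set Implicit Arguments.
Unset Strict Implicit.
Unset Printing Implicit Defensive.
Import Order.TTheory GRing.Theory Num.Theory.
Import numFieldNormedType.Exports.
Local Open Scope classical_set_scope.
Local Open Scope ring_scope.

Definition mutually_independent (d : measure_display) (T : measurableType d)
    (R : realType) (P : probability T R) (I : choiceType)
    (X : I -> {RV P >-> R}) : Prop :=
  forall (J : {fset I}) (A : I -> set R), (forall i, measurable (A i)) ->
    P (\bigcap_(i in [set` J]) X i @^-1` A i) =
    (\prod_(i <- J) P (X i @^-1` A i))%E.

Definition cvg_in_distribution (R : realType)
    (d : measure_display) (T : measurableType d) (P : probability T R)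
    (d' : measure_display) (T' : measurableType d') (Q : probability T' R)
    (Y : nat -> {RV P >-> R}) (xi : {RV Q >-> R}) : Prop :=
  forall x : R, {for x, continuous (cdf xi)} ->
    cdf (Y m) x @[m --> \oo] --> cdf xi x.

(* The sample X_1, ..., X_n is X 0, ..., X n.-1, and the rank j runs over
   1, ..., n: [order_stat X n j] is X_(j). *)
Definition order_stat (d : measure_display) (T : measurableType d)
    (R : realType) (P : probability T R) (X : nat -> {RV P >-> R})
    (n j : nat) (w : T) : R :=
  nth 0 (sort <=%R (mkseq (fun i => X i w) n)) j.-1.

Lemma order_stat_le (d : measure_display) (T : measurableType d)
    (R : realType) (P : probability T R) (X : nat -> {RV P >-> R})
    (n j : nat) (w : T) (x : R) : (j.-1 < n)%N ->
  (order_stat X n j w <= x) = (j.-1 < \sum_(i < n) (X i w <= x)%R)%N.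
Proof.
move=> jn; rewrite /order_stat; set s := mkseq _ _.
have -> : (\sum_(i < n) (X i w <= x)%R)%N = count (fun y => y <= x) s.
  rewrite -(big_mkord xpredT (fun i => (X i w <= x)%R : nat)) -sum1_count.
  by rewrite [RHS]big_mkcond/= big_map /index_iota subn0.
have sz : size (sort <=%R s) = n by rewrite size_sort size_mkseq.
have so : sorted <=%R (sort <=%R s) by apply: sort_sorted; exact: le_total.
rewrite -(permP (permEl (perm_sort <=%R s))).
move: (sort _ _) sz so => t; move: (j.-1) jn => {s} i.
elim: t n i => [|a t IH] [|n] [|i] //= jn [sz] so.
  case: (leP a x) => // ax; rewrite add0n; apply/esym/negbTE.
  rewrite -leqNgt leqn0 -leqn0 leqNgt -has_count.
  apply/hasPn => y yt; rewrite -ltNge (lt_le_trans ax)//.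
  by move: so; rewrite (path_sortedE (@le_trans _ _)) => /andP[/allP/(_ _ yt)].
rewrite (IH n i jn sz (path_sorted so)).
case: (leP a x) => [|ax] //=; rewrite add0n.
have -> : count (fun y => y <= x) t = 0%N.
  apply/eqP; rewrite -leqn0 leqNgt -has_count; apply/hasPn => y yt.
  rewrite -ltNge (lt_le_trans ax)//.
  by move: so; rewrite (path_sortedE (@le_trans _ _)) => /andP[/allP/(_ _ yt)].
by [].
Qed.

Lemma measurable_order_stat (d : measure_display) (T : measurableType d)
    (R : realType) (P : probability T R) (X : nat -> {RV P >-> R})
    (n j : nat) : measurable_fun [set: T] (order_stat X n j).
Proof.
have [jn|nj] := ltnP j.-1 n; last first.
  rewrite (_ : order_stat _ _ _ = cst 0); first exact: measurable_cst.
  by apply/funext => w; rewrite /order_stat nth_default// size_sort size_mkseq.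
apply: (measurability _ (RGenOInfty.measurableE R)).
move=> _ [_ [x ->] <-]; rewrite setTI.
rewrite (_ : _ @^-1` _ = ~` [set w | (j.-1 < \sum_(i < n) (X i w <= x)%R)%N]);
  last first.
  apply/seteqP; split => w /=; rewrite -order_stat_le// in_itv/= andbT.
    by rewrite ltNge => /negP.
  by move=> /negP; rewrite -ltNge.
apply: measurableC.
pose g w : R := \sum_(i <- enum 'I_n) \1_(X i @^-1` `]-oo, x]) w.
have mg : measurable_fun [set: T] g.
  by apply: measurable_sum => i; apply: measurable_indic; exact: measurable_funPTI.
rewrite (_ : mkset _ = g @^-1` `]j.-1%:R, +oo[).
  by rewrite -[X in measurable X]setTI; exact: mg.
rewrite /preimage; apply: eq_set => w.
rewrite /= in_itv/= andbT /g big_enum/= -(ltr_nat R) natr_sum.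
congr (is_true (_ < _)); apply: eq_bigr => i _.
rewrite indicE; congr (nat_of_bool _)%:R.
by apply/idP/idP; rewrite inE /= in_itv.
Qed.

HB.instance Definition _ (d : measure_display) (T : measurableType d)
    (R : realType) (P : probability T R) (X : nat -> {RV P >-> R}) (n j : nat) :=
  isMeasurableFun.Build _ _ _ _ (order_stat X n j)
    (measurable_order_stat X n j).

(* [ln] takes the junk value 0 outside the positive reals; when F is the
   distribution function of each X i this only concerns the null events
   F (X i) = 1. *)
Definition tail_stat (d : measure_display) (T : measurableType d)
    (R : realType) (P : probability T R) (F : cumulativeBounded (0 : R) (1 : R))
    (X : nat -> {RV P >-> R}) (k n : nat) (w : T) : R :=
  ln (1 - F (order_stat X n (n - k) w)) -
  k%:R^-1 * \sum_(n - k + 1 <= i < n.+1) ln (1 - F (order_stat X n i w)).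

Lemma measurable_tail_stat (d : measure_display) (T : measurableType d)
    (R : realType) (P : probability T R) (F : cumulativeBounded (0 : R) (1 : R))
    (X : nat -> {RV P >-> R}) (k n : nat) :
  measurable_fun [set: T] (tail_stat F X k n).
Proof.
have mln j : measurable_fun [set: T] (fun w => ln (1 - F (order_stat X n j w))).
  apply: measurableT_comp => //; apply: measurable_funB => //.
  apply: measurableT_comp => //; apply: nondecreasing_measurable => //.
  exact: cumulative_is_nondecreasing.
apply: measurable_funB => //; apply: measurable_funM => //.
exact: measurable_sum.
Qed.

HB.instance Definition _ (d : measure_display) (T : measurableType d)
    (R : realType) (P : probability T R) (F : cumulativeBounded (0 : R) (1 : R))
    (X : nat -> {RV P >-> R}) (k n : nat) :=
  isMeasurableFun.Build _ _ _ _ (tail_stat F X k n)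
    (measurable_tail_stat F X k n).

(* Main.v *)
Require Import Defs.
From HB Require Import structures.
From mathcomp Require Import all_boot all_order all_algebra finmap.
From mathcomp Require Import zify ring lra.
From mathcomp Require Import all_classical all_reals all_analysis measurable_realfun.
Set Implicit Arguments.
Unset Strict Implicit.
Unset Printing Implicit Defensive.
Import Order.TTheory GRing.Theory Num.Theory.
Import numFieldNormedType.Exports.
Local Open Scope classical_set_scope.
Local Open Scope ring_scope.

(** The scores [E_i = - ln (1 - F0 X_i)] are i.i.d. standard exponential, and
  [k * R_{k,n}] is the sum of the excesses of the [k] largest scores over the
  next one.  Almost surely there are no ties, so the event [R_{k,n} <= r] is the
  disjoint union over [j] of the events that exactly [k] of the other scores exceed
  [E_j] and that their excesses over [E_j] sum to at most [k * r].  Integrating out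
  the other scores one at a time, for fixed [E_j], lack of memory makes the
  probability of each such event [C_j * P (Gamma(k) <= k * r)]; letting [r] tend
  to infinity gives [\sum_j C_j = 1].  Hence [k * R_{k,n}] is exactly
  Gamma(k)-distributed whatever [n] is.  Finally the rescaled Gamma(k) densities,
  normalised to be [1] at their centre, converge pointwise to
  [expR (- (u ^+ 2 / 2))] and are dominated by [expR (3 / 2 - `|u| / 4)]; dividing
  an integral over a half-line by the total mass avoids Stirling's formula. *)

(** * Measures on the line and on products *)

(** Complements turn the rays of the distribution functions into open right rays, which are stable
    under intersection and generate the Borel sets. *)
Lemma eq_probability_cdf (R : realType) (mu nu : probability (measurableTypeR R) R) :
  (forall x : R, mu `]-oo, x]%classic = nu `]-oo, x]%classic) ->
  forall A, measurable A -> mu A = nu A.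
Proof.
move=> h; apply: (@measure_unique _ R (measurableTypeR R) (@RGenOInfty.G R)
  (fun n => `]- n%:R, +oo[%classic) _ _ _ _ mu nu).
- exact: RGenOInfty.measurableE.
- move=> _ _ [x ->] [y ->]; exists (Num.max x y).
  apply/seteqP; split=> z /=; rewrite !in_itv/= !andbT gt_max.
    by move=> [-> ->].
  by move=> /andP.
- by move=> n; exists (- n%:R).
- rewrite -subTset => x _; exists (Num.truncn (- x)).+1 => //=.
  by rewrite in_itv/= andbT ltrNl truncnS_gt.
- move=> _ [x ->]; rewrite -setCitvl.
  transitivity (1 - mu `]-oo, x]%classic)%E; first exact: (probability_setC mu).
  by rewrite h; apply/esym; exact: (probability_setC nu).
- by move=> n; rewrite (le_lt_trans (probability_le1 _ _)) ?ltry.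
Qed.

(** Change of variables holds for the Radon-Nikodym derivative of [nu]; since [p] has the same
    integrals over all measurable sets, the two agree almost everywhere. *)
Lemma ge0_integral_density d (T : measurableType d) (R : realType)
    (mu : {sigma_finite_measure set T -> \bar R})
    (nu : {finite_measure set T -> \bar R}) (p f : T -> \bar R) :
  measurable_fun setT p -> (forall x, 0 <= p x)%E ->
  (forall A, measurable A -> nu A = \int[mu]_(x in A) p x)%E ->
  measurable_fun setT f -> (forall x, 0 <= f x)%E ->
  (\int[nu]_x f x = \int[mu]_x (f x * p x))%E.
Proof.
move=> mp p0 nuE mf f0.
have numu : nu `<< mu.
  apply/null_content_dominatesP => A mA muA0.
  by rewrite nuE// null_set_integral//; exact: measurable_funTS.
have ip : mu.-integrable setT p.
  apply/integrableP; split => //.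
  under eq_integral do rewrite gee0_abs//.
  by rewrite -nuE// -ge0_fin_numE// fin_num_measure.
rewrite -(Radon_Nikodym_SigmaFinite.change_of_variables numu)//.
have iRN := Radon_Nikodym_SigmaFinite.f_integrable numu.
apply: ge0_ae_eq_integral => //.
- by apply: emeasurable_funM => //; exact: measurable_int iRN.
- exact: emeasurable_funM.
- by move=> x _; rewrite mule_ge0// Radon_Nikodym_SigmaFinite.f_ge0.
- by move=> x _; rewrite mule_ge0.
apply: ae_eqe_mul2l; apply: integral_ae_eq => //.
by move=> A _ mA; rewrite -Radon_Nikodym_SigmaFinite.f_integral// nuE.
Qed.

Lemma rectangle_measure_unique d1 d2 (S : measurableType d1) (V : measurableType d2)
    (R : realType) (m1 m2 : {measure set (S * V) -> \bar R}) :
  (m1 setT < +oo)%E ->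
  (forall A B, measurable A -> measurable B -> m1 (A `*` B) = m2 (A `*` B)) ->
  forall W, measurable W -> m1 W = m2 W.
Proof.
move=> m1T m12; apply: (measure_unique
  [set A `*` B | A in measurable & B in measurable] (fun=> setT)) => //.
- exact: measurable_prod_measurableType.
- move=> _ _ [A mA [B mB <-]] [A' mA' [B' mB' <-]]; rewrite -setXI.
  by exists (A `&` A'); [exact: measurableI|exists (B `&` B') => //; exact: measurableI].
- by move=> _; exists setT => //; exists setT => //; rewrite setXTT.
- by rewrite bigcup_const//; exists 0%N.
- by move=> _ [A mA [B mB <-]]; exact: m12.
Qed.

Section independence.
Context d (T : measurableType d) (R : realType) (P : probability T R).
Local Open Scope ereal_scope.

(** Both sides are finite measures in [W]: the image under [(Z, Y)] of [P] restricted to [C], and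
    the image of [P] scaled by [P C]. Agreement on rectangles therefore suffices. *)
Lemma indep_pair_restr d1 d2 (S : measurableType d1) (V : measurableType d2)
    (Z : T -> S) (Y : T -> V) (C : set T) :
  measurable_fun setT Z -> measurable_fun setT Y -> measurable C ->
  (forall A B, measurable A -> measurable B ->
    P (Z @^-1` A `&` Y @^-1` B `&` C) = P (Z @^-1` A `&` Y @^-1` B) * P C) ->
  forall W, measurable W ->
  P ((fun w => (Z w, Y w)) @^-1` W `&` C) = P ((fun w => (Z w, Y w)) @^-1` W) * P C.
Proof.
move=> mZ mY mC H.
have mZY : measurable_fun setT (fun w => (Z w, Y w)) by exact: measurable_fun_pair.
pose m1 := measure_function_pushforward__canonical__measure_function_Measure
  (mrestr P mC) mZY.
have PC0 : (0 <= fine (P C))%R by rewrite fine_ge0.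
pose m2 := mscale (NngNum PC0)
  (measure_function_pushforward__canonical__measure_function_Measure P mZY).
move=> W mW.
transitivity (m2 W); last by rewrite /m2/= /mscale/= fineK ?fin_num_measure// muleC.
apply: (@rectangle_measure_unique _ _ _ _ _ m1 m2) => //.
  rewrite /m1/= /pushforward /mrestr (le_lt_trans (probability_le1 _ _)) ?ltry//.
  by apply: measurableI => //; rewrite preimage_setT.
move=> A B mA mB; rewrite /m1/m2/= /mscale /pushforward/= /mrestr.
rewrite fineK ?fin_num_measure// muleC -H//.
Qed.

(** The joint law of [(Z, Y)] is the product of the law of [Z] with [nu], so Tonelli's theorem
    integrates [Y] out while [Z] stays fixed. *)
Lemma indep_pair_integral d1 d2 (S : measurableType d1) (V : measurableType d2)
    (Z : T -> S) (Y : T -> V) (nu : probability V R) (f : S * V -> \bar R) :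
  measurable_fun setT Z -> measurable_fun setT Y ->
  (forall A B, measurable A -> measurable B ->
    P (Z @^-1` A `&` Y @^-1` B) = P (Z @^-1` A) * nu B) ->
  measurable_fun setT f -> (forall x, 0 <= f x) ->
  \int[P]_w f (Z w, Y w) = \int[P]_w \int[nu]_y f (Z w, y).
Proof.
move=> mZ mY H mf f0.
have mZY : measurable_fun setT (fun w => (Z w, Y w)) by exact: measurable_fun_pair.
pose Z' : {mfun T >-> S} := HB.pack Z (isMeasurableFun.Build _ _ _ _ Z mZ).
rewrite -(@ge0_integral_pushforward _ _ _ _ _ _ mZY P setT f)//.
rewrite (@eq_measure_integral _ _ _ _ (distribution P Z' \x nu)); last first.
  move=> W mW _; apply: rectangle_measure_unique => //.
    by rewrite /= /pushforward preimage_setT (le_lt_trans (probability_le1 _ _)) ?ltry.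
  move=> A B mA mB; rewrite [RHS]product_measure1E//.
  exact: H.
rewrite fubini_tonelli1// ge0_integral_pushforward//.
- exact: measurable_fun_fubini_tonelli_F.
- by move=> s _; apply: integral_ge0 => y _.
Qed.

End independence.

(** * Independent families *)

Section independent_family.
Context d (T : measurableType d) (R : realType) (P : probability T R).
Context d2 (V : measurableType d2) (E : nat -> T -> V).
Local Open Scope ereal_scope.

Definition cylinder (s : seq nat) (A : nat -> set V) : set T :=
  \big[setI/setT]_(i <- s) E i @^-1` A i.

(** Duplicate-free sequences, rather than finite sets, index the events so that scores can be
    handled one at a time by induction. *)
Definition indep_family := forall (s : seq nat) (A : nat -> set V),
  uniq s -> (forall i, measurable (A i)) ->
  P (cylinder s A) = \prod_(i <- s) P (E i @^-1` A i).

(* [Z] is independent of the members of the family with index outside [D]. *)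
Definition indep_outside d1 (S : measurableType d1) (D : seq nat) (Z : T -> S) :=
  forall (s : seq nat) (A : nat -> set V) B,
  uniq s -> ~~ has (mem D) s -> (forall i, measurable (A i)) -> measurable B ->
  P (Z @^-1` B `&` cylinder s A) = P (Z @^-1` B) * P (cylinder s A).

Hypothesis mE : forall i, measurable_fun setT (E i).
Hypothesis E_indep : indep_family.

Lemma measurable_cylinder s A : (forall i, measurable (A i)) ->
  measurable (cylinder s A).
Proof.
move=> mA; apply: bigsetI_measurable => i _.
by rewrite -[X in measurable X]setTI; exact: mE.
Qed.

(** Overriding [A] at [i] absorbs one more constraint into a single cylinder, the form in which
    independence hypotheses can be applied. *)
Lemma cylinder_cons i s A B :
  i \notin s -> cylinder (i :: s) (fun j => if j == i then B else A j) =
    E i @^-1` B `&` cylinder s A.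
Proof.
move=> iNs; rewrite /cylinder big_cons eqxx; congr (_ `&` _).
by apply: eq_big_seq => j js; case: eqP => // ji; rewrite -ji js in iNs.
Qed.

Lemma indep_cylinder_cons i s A B : i \notin s -> uniq s ->
  (forall i, measurable (A i)) -> measurable B ->
  P (E i @^-1` B `&` cylinder s A) = P (E i @^-1` B) * P (cylinder s A).
Proof.
move=> iNs us mA mB; rewrite -cylinder_cons// !E_indep//=.
- rewrite big_cons eqxx; congr (_ * _).
  by apply: eq_big_seq => j js; case: eqP => // ji; rewrite -ji js in iNs.
- by rewrite iNs.
- by move=> j; case: ifP.
Qed.

Lemma indep_outside_self i : indep_outside [:: i] (E i).
Proof.
move=> s A B us sD mA mB; apply: indep_cylinder_cons => //.
by apply: contra sD => ?; apply/hasP; exists i => //=; rewrite inE.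
Qed.

Section step.
Context d1 (S : measurableType d1) (D : seq nat) (Z : T -> S) (i : nat).
Hypothesis mZ : measurable_fun setT Z.
Hypothesis Z_indep : indep_outside D Z.
Hypothesis iND : i \notin D.

Lemma indep_outside_pair A B : measurable A -> measurable B ->
  P (Z @^-1` A `&` E i @^-1` B) = P (Z @^-1` A) * P (E i @^-1` B).
Proof.
move=> mA mB; have := @Z_indep [:: i] (fun=> B) A isT.
by rewrite /cylinder big_seq1/= orbF; apply.
Qed.

(** A statistic built up score by score remains independent of the scores not yet used; this is what
    drives the induction over the sample. *)
Lemma indep_outside_step (f : S * V -> S) : measurable_fun setT f ->
  indep_outside (i :: D) (fun w => f (Z w, E i w)).
Proof.
move=> mf s A B us sD mA mB.
have [iNs sND] : i \notin s /\ ~~ has (mem D) s.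
  split; apply: contra sD.
    by move=> si; apply/hasP; exists i => //=; rewrite inE eqxx.
  by move=> /hasP[j js jD]; apply/hasP; exists j => //=; rewrite inE; apply/orP; right.
have -> : (fun w => f (Z w, E i w)) @^-1` B =
    (fun w => (Z w, E i w)) @^-1` (f @^-1` B) by [].
apply: indep_pair_restr => //.
- exact: measurable_cylinder.
(* On a rectangle, the constraint on [E i] joins the cylinder over [s]; the enlarged index list
   still avoids [D], so [Z] splits off first and [E i] next. *)
- move=> A1 B1 mA1 mB1; rewrite -setIA -cylinder_cons// Z_indep//=.
  + rewrite cylinder_cons// indep_cylinder_cons// muleA; congr (_ * _).
    by rewrite indep_outside_pair.
  + by rewrite iNs.
  + by rewrite negb_or iND.
  + by move=> j; case: ifP.
- by rewrite -[X in measurable X]setTI; exact: mf.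
Qed.

Lemma indep_outside_integral (nu : probability V R) (g : S * V -> \bar R) :
  (forall B, measurable B -> P (E i @^-1` B) = nu B) ->
  measurable_fun setT g -> (forall x, 0 <= g x) ->
  \int[P]_w g (Z w, E i w) = \int[P]_w \int[nu]_y g (Z w, y).
Proof.
move=> nuE mg g0; apply: indep_pair_integral => // A B mA mB.
by rewrite indep_outside_pair// nuE.
Qed.

End step.

End independent_family.

(** * Gamma distribution functions *)

Section gamma_cdf.
Context {R : realType}.
Implicit Types (r : nat) (u x t c : R).

(** Besides the Poisson(u) mass at [r], this is the Gamma density of shape [r.+1] at [u]. *)
Definition poisson_term r u : R := expR (- u) * (u ^+ r / r`!%:R).

(** Keeping the formula for negative [u] as well makes it differentiable on the whole line, so that
    no one-sided derivative arises at 0. *)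
Definition poisson_ccdf r u : R := 1 - \sum_(j < r) poisson_term j u.

(* For integer shape [r], Gamma(r) is at most [u] exactly when a Poisson(u)
   variable is at least [r]; shape 0 is the Dirac mass at 0. *)
Definition gamma_cdf r u : R := if u < 0 then 0 else poisson_ccdf r u.

Lemma poisson_term_ge0 r u : 0 <= u -> 0 <= poisson_term r u.
Proof. by move=> u0; rewrite mulr_ge0 ?expR_ge0// divr_ge0// exprn_ge0. Qed.

Lemma poisson_ccdfS r u :
  poisson_ccdf r.+1 u = poisson_ccdf r u - poisson_term r u.
Proof. by rewrite /poisson_ccdf big_ord_recr/= opprD addrA. Qed.

Lemma poisson_ccdf0 u : poisson_ccdf 0 u = 1.
Proof. by rewrite /poisson_ccdf big_ord0 subr0. Qed.

Lemma poisson_ccdfS0 r : poisson_ccdf r.+1 0 = 0.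
Proof.
elim: r => [|r IH]; rewrite poisson_ccdfS ?poisson_ccdf0 ?IH /poisson_term.
  by rewrite oppr0 expR0 expr0 fact0 divr1 mulr1 subrr.
by rewrite expr0n/= mul0r mulr0 subr0.
Qed.

Lemma is_derive_poisson_term0 u :
  is_derive u 1 (poisson_term 0) (- poisson_term 0 u).
Proof.
have -> : poisson_term 0 = expR \o -%R.
  by apply/funext => x; rewrite /poisson_term/= expr0 fact0 divr1 mulr1.
apply: is_derive_eq => /=.
by rewrite mulrN1.
Qed.

Lemma is_derive_poisson_termS r u :
  is_derive u 1 (poisson_term r.+1) (poisson_term r u - poisson_term r.+1 u).
Proof.
have -> : poisson_term r.+1 =
    poisson_term 0 * ((r.+1)`!%:R^-1 \*: (@id R) ^+ r.+1).
  apply/funext => x; rewrite /poisson_term !fctE/= expr0 fact0 divr1 mulr1.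
  by rewrite [_ *: _]mulrC.
have d0 := is_derive_poisson_term0 u.
have dX : is_derive u 1 (@id R ^+ r.+1) (r.+1%:R * u ^+ r).
  by apply: is_derive_eq; rewrite /= [_ *: _]mulr1.
have dZ := is_deriveZ (r.+1)`!%:R^-1 dX.
apply: (is_derive_eq (is_deriveM d0 dZ)); rewrite !fctE/=.
rewrite /poisson_term expr0 fact0 divr1 mulr1 factS natrM /GRing.scale/= exprS.
have r0 : r`!%:R != 0 :> R by rewrite pnatr_eq0 -lt0n fact_gt0.
have r1 : (1 + r%:R) != 0 :> R by rewrite addrC natr1 pnatr_eq0.
by rewrite -natr1; field; rewrite ?r0 ?r1 -?natr1 ?[_ + 1]addrC ?r1.
Qed.

(** The derivatives of the successive Poisson terms telescope, and only the Gamma density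
    remains. *)
Lemma is_derive_poisson_ccdf r u :
  is_derive u 1 (poisson_ccdf r.+1) (poisson_term r u).
Proof.
elim: r => [|r IH].
  have -> : poisson_ccdf 1 = cst 1 - poisson_term 0.
    by apply/funext => x; rewrite poisson_ccdfS poisson_ccdf0.
  have d0 := is_derive_poisson_term0 u.
  by apply: is_derive_eq; rewrite sub0r opprK.
have -> : poisson_ccdf r.+2 = poisson_ccdf r.+1 - poisson_term r.+1.
  by apply/funext => x; rewrite poisson_ccdfS.
have dS := is_derive_poisson_termS r u.
by apply: is_derive_eq; rewrite opprB addrC subrK.
Qed.

Lemma continuous_poisson_ccdf r : continuous (poisson_ccdf r).
Proof.
case: r => [|r] x.
  rewrite (_ : poisson_ccdf 0 = cst 1); first exact: cvg_cst.
  by apply/funext => y; rewrite poisson_ccdf0.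
apply: differentiable_continuous; apply/derivable1_diffP.
by have dp := is_derive_poisson_ccdf r x; exact: ex_derive.
Qed.

(** Convolution with one more exponential variable raises the Gamma shape by one; the factor
    [expR (- t)] is the probability of exceeding [t]. *)
Lemma integral_poisson_ccdf_shift r t c : 0 < c ->
  (\int[lebesgue_measure]_(x in `[t, (t + c)%R])
     (poisson_ccdf r (t + c - x) * expR (- x))%:E =
   (expR (- t) * poisson_ccdf r.+1 c)%:E)%E.
Proof.
move=> c0.
(* In the derivative of this product the term [poisson_term r] restores [poisson_ccdf r] from
   [poisson_ccdf r.+1]; at the right endpoint [F] vanishes. *)
pose F x := - (expR (- x) * poisson_ccdf r.+1 (t + c - x)).
have dF x : is_derive x 1 F (poisson_ccdf r (t + c - x) * expR (- x)).
  have -> : F = - ((expR \o -%R) * (poisson_ccdf r.+1 \o (fun x => t + c - x))).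
    by apply/funext.
  have d1 : is_derive x 1 (poisson_ccdf r.+1 \o (fun x => t + c - x))
     (poisson_term r (t + c - x) * -1).
    have d2 : is_derive x 1 (fun x => t + c - x) (-1).
      have -> : (fun x : R => t + c - x) = cst (t + c) - id by apply/funext.
      by apply: is_derive_eq; rewrite sub0r.
    apply: is_derive1_comp; exact: is_derive_poisson_ccdf.
  apply: is_derive_eq => /=; rewrite poisson_ccdfS /GRing.scale/=.
  by ring.
rewrite (@continuous_FTC2 _ _ F).
- by rewrite -EFinB /F subrr poisson_ccdfS0 mulr0 oppr0 sub0r opprK [t + c]addrC addrK.
- by rewrite ltrDl.
- apply: continuous_subspaceT => x; apply: cvgM.
    apply: (@continuous_comp _ _ _ (fun x => t + c - x)); last exact: continuous_poisson_ccdf.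
    by apply: cvgB; [exact: cvg_cst|exact: cvg_id].
  apply: (@continuous_comp _ _ _ -%R); last exact: continuous_expR.
  by apply: cvgN; exact: cvg_id.
- have cF x : {for x, continuous F}.
    by apply: differentiable_continuous; apply/derivable1_diffP; have dFx := dF x; exact: ex_derive.
  split => [x _||].
  + have dFx := dF x; exact: ex_derive.
  + by apply: cvg_at_right_filter; exact: cF.
  + by apply: cvg_at_left_filter; exact: cF.
- by move=> x _; rewrite derive1E; have dFx := dF x; exact: derive_val.
Qed.

End gamma_cdf.

(** * Bounds and limits of Gamma distribution functions, and integrals against the exponential
    law *)

Section gamma_cdf_theory.
Context {R : realType}.
Implicit Types (r : nat) (u x t c : R).

(** For positive shape the function starts from 0 at the origin and has a nonnegative derivative to
    its right. *)
Lemma poisson_ccdf_ge0 r u : 0 <= u -> 0 <= poisson_ccdf r u.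
Proof.
move=> u0; case: r => [|r]; first by rewrite poisson_ccdf0.
rewrite -[leLHS](@poisson_ccdfS0 R r).
apply: (@ger0_derive1_le_cc _ _ 0 u) => //; rewrite ?in_itv/= ?lexx ?u0//.
- by move=> x _; have dp := is_derive_poisson_ccdf r x; exact: ex_derive.
- move=> x; rewrite in_itv/= => /andP[x0 _]; rewrite derive1E.
  have dp := is_derive_poisson_ccdf r x; rewrite derive_val.
  by rewrite poisson_term_ge0// ltW.
- by apply: continuous_subspaceT; exact: continuous_poisson_ccdf.
Qed.

Lemma gamma_cdf_ge0 r u : 0 <= gamma_cdf r u.
Proof. by rewrite /gamma_cdf; case: ltP => // u0; exact: poisson_ccdf_ge0. Qed.

Lemma gamma_cdf_ge0E r u : 0 <= u -> gamma_cdf r u = poisson_ccdf r u.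
Proof. by rewrite /gamma_cdf; case: ltP. Qed.

Lemma measurable_gamma_cdf r : measurable_fun setT (@gamma_cdf R r).
Proof.
apply: measurable_fun_ifT => //.
  exact: measurable_fun_ltr.
by apply: continuous_measurable_fun; exact: continuous_poisson_ccdf.
Qed.

Lemma cvg_poisson_term r : poisson_term r u @[u --> +oo] --> (0 : R).
Proof.
apply: (@squeeze_cvgr _ _ _ _ (fun=> 0) (fun u => r.+1%:R * u^-1)).
- near=> u; have u0 : 0 < u by near: u; exact: nbhs_pinfty_gt.
  rewrite poisson_term_ge0 ?(ltW u0)//=.
  (* A single term of the exponential series is at most [expR u]; the term of degree [r.+1] leaves a
     bound of order [u^-1]. *)
  have h : u ^+ r.+1 / r.+1`!%:R <= expR u.
    by rewrite (le_trans _ (expR_ge1Dxn r (ltW u0)))// lerDr.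
  have -> : poisson_term r u =
      (u ^+ r.+1 / r.+1`!%:R * expR (- u)) * (r.+1%:R * u^-1).
    rewrite /poisson_term factS natrM exprS.
    have r0 : r`!%:R != 0 :> R by rewrite pnatr_eq0 -lt0n fact_gt0.
    have r1 : (1 + r%:R) != 0 :> R by rewrite addrC natr1 pnatr_eq0.
    rewrite -natr1; field; rewrite ?r0 ?r1 -?natr1 ?[_ + 1]addrC ?r1 (gt_eqF u0)//.
  rewrite ler_piMl// ?mulr_ge0 ?invr_ge0 ?(ltW u0)//.
  by rewrite expRN ler_pdivrMr ?expR_gt0// mul1r.
- exact: cvg_cst.
- rewrite -[X in _ --> X](mulr0 r.+1%:R); apply: cvgM; first exact: cvg_cst.
  apply/gtr0_cvgV0; first exact: nbhs_pinfty_gt.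
  exact: cvg_id.
Unshelve. all: by end_near. Qed.

Lemma cvg_poisson_ccdf r : poisson_ccdf r u @[u --> +oo] --> (1 : R).
Proof.
elim: r => [|r IH].
  rewrite (_ : poisson_ccdf 0 = cst 1); first exact: cvg_cst.
  by apply/funext => u; rewrite poisson_ccdf0.
rewrite (_ : poisson_ccdf _ = poisson_ccdf r \- poisson_term r); last first.
  by apply/funext => u; rewrite poisson_ccdfS.
by rewrite -[X in _ --> X]subr0; apply: cvgB => //; exact: cvg_poisson_term.
Qed.

Definition std_exponential : probability (measurableTypeR R) R :=
  exponential_distribution_exponential_prob__canonical__probability_measure_Probability
    (@ltr01 R).

Lemma ge0_integral_exponential (mu : probability (measurableTypeR R) R)
    (f : measurableTypeR R -> \bar R) :
  (forall A, measurable A -> mu A = exponential_prob 1 A) ->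
  measurable_fun setT f -> (forall x, 0 <= f x)%E ->
  (\int[mu]_x f x =
   \int[lebesgue_measure]_(x in `[0%R, +oo[) (f x * (expR (- x))%:E))%E.
Proof.
move=> muE mf f0.
rewrite (@ge0_integral_density _ _ _ lebesgue_measure mu
  (EFin \o exponential_pdf 1))//; last 2 first.
- by apply/measurable_EFinP; exact: measurable_exponential_pdf.
- by move=> x; rewrite lee_fin exponential_pdf_ge0.
rewrite [RHS]integral_mkcond; apply: eq_integral => x _ /=.
rewrite /exponential_pdf !patchE; case: ifPn => _; last by rewrite mule0.
by rewrite mulN1r mul1r.
Qed.

Lemma exponential_prob_itvNyc x :
  exponential_prob 1 `]-oo, x]%classic = (gamma_cdf 1 x)%:E.
Proof.
rewrite /exponential_prob /gamma_cdf; case: ltP => x0.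
  rewrite integral0_eq// => y; rewrite /= in_itv/= => yx.
  by rewrite lt0_exponential_pdf// (le_lt_trans yx).
transitivity (\int[lebesgue_measure]_(y in `[0%R, x]) (exponential_pdf 1 y)%:E)%E.
  rewrite [LHS]integral_mkcond [RHS]integral_mkcond; apply: eq_integral => y _.
  rewrite !patchE !mem_setE !in_itv/=; have [y0|y0] := leP 0 y => //=.
  by rewrite lt0_exponential_pdf// if_same.
rewrite poisson_ccdfS poisson_ccdf0 /poisson_term expr0 fact0 divr1 mulr1.
have [->|xn0] := eqVneq x 0.
  by rewrite set_itv1 integral_set1 oppr0 expR0 subrr.
have := @exponential_prob_itv0c R 1 x; rewrite /exponential_prob => -> //.
  by rewrite mulN1r EFinB.
by rewrite lt_neqAle eq_sym xn0.
Qed.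

Lemma exponential_prob_cdf (mu : probability (measurableTypeR R) R) :
  (forall x, mu `]-oo, x]%classic = (gamma_cdf 1 x)%:E) ->
  forall A, measurable A -> mu A = exponential_prob 1 A.
Proof.
move=> h.
by apply: (@eq_probability_cdf _ mu std_exponential) => x; rewrite h -exponential_prob_itvNyc.
Qed.

(* Lack of memory: the excess over [t] is again exponential. *)
Lemma integral_exponential_shift (mu : probability (measurableTypeR R) R) r t c :
  (forall A, measurable A -> mu A = exponential_prob 1 A) -> 0 <= t ->
  (\int[mu]_x ((t < x)%R%:R * gamma_cdf r (c - (x - t)))%:E =
   (expR (- t) * gamma_cdf r.+1 c)%:E)%E.
Proof.
move=> muE t0; rewrite ge0_integral_exponential//; last 2 first.
- apply/measurable_EFinP; apply: measurable_funM.
    apply: (measurableT_comp (f := fun b : bool => b%:R : R)) => //.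
    exact: measurable_fun_ltr.
  apply: measurableT_comp; first exact: measurable_gamma_cdf.
  by apply: measurable_funB => //; exact: measurable_funB.
- by move=> x; rewrite lee_fin mulr_ge0// gamma_cdf_ge0.
(* When [c <= 0], the argument [c - (x - t)] is negative for every [x] above [t], so the integral
   vanishes; at [c = 0] the right side vanishes too because its shape is positive. *)
have [c0|c0|c0] := ltgtP c 0.
- rewrite [in RHS]/gamma_cdf c0 mulr0 integral0_eq// => x _.
  case: ltP => tx; rewrite ?mul0r ?mul0e//.
  rewrite /gamma_cdf ifT ?mulr0 ?mul0e//.
  by rewrite subr_lt0 (lt_trans c0)// subr_gt0.
- rewrite (gamma_cdf_ge0E _ (ltW c0)) -integral_poisson_ccdf_shift//.
  rewrite -integral_itv_obnd_cbnd; last first.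
    apply: measurable_funTS; apply/measurable_EFinP; apply: measurable_funM.
      apply: measurableT_comp => //.
        by apply: continuous_measurable_fun; exact: continuous_poisson_ccdf.
      exact: measurable_funB.
    by apply: measurableT_comp => //; apply: measurableT_comp.
  rewrite [LHS]integral_mkcond [RHS]integral_mkcond; apply: eq_integral => x _.
  rewrite !patchE !mem_setE !in_itv/= andbT.
  have [tx|xt] := ltP t x; last by rewrite /= mul0r mul0e if_same.
  rewrite (le_trans t0 (ltW tx)) mul1r/= -EFinM opprB addrA [c + t]addrC.
  rewrite /gamma_cdf subr_lt0; case: ltP => // _.
  by rewrite mul0r.
- rewrite c0 gamma_cdf_ge0E// poisson_ccdfS0 mulr0 integral0_eq// => x _.
  case: ltP => tx; rewrite ?mul0r ?mul0e//.
  rewrite /gamma_cdf ifT ?mulr0 ?mul0e//.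
  by rewrite sub0r oppr_lt0 subr_gt0.
Qed.

End gamma_cdf_theory.

(** * Excesses over a given score *)

Section gap_statistic.
Context {R : realType}.
Local Notation V := (measurableTypeR R).
Implicit Types (m r k : nat) (t c : R).

(* A state [(t, N, S)] records the level [t], the number [N] of scores seen so far
   above [t], and the sum [S] of their excesses over [t]. *)
Definition gap_state := (V * nat * V)%type.

Definition gap_step (p : gap_state * V) : gap_state :=
  (p.1.1.1, (p.1.1.2 + (p.1.1.1 < p.2)%R)%N,
   p.1.2 + ((p.1.1.1 < p.2)%R)%:R * (p.2 - p.1.1.1)).

(* Binomial probability that [r] of [m] exponential scores exceed [t], by Pascal's
   rule. *)
Fixpoint exceed_pmf m r t : R :=
  if m is m'.+1 then
    (1 - expR (- t)) * exceed_pmf m' r t +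
    expR (- t) * (if r is r'.+1 then exceed_pmf m' r' t else 0)
  else (r == 0)%:R.

(* The probability that, starting from [z], the state reached after [m] further
   scores has [N = k] and [S <= c]. *)
Definition gap_value m k c (z : gap_state) : R :=
  \sum_(r < k.+1) (z.1.2 + r == k)%N%:R *
    (exceed_pmf m r z.1.1 * gamma_cdf r (c - z.2)).

Lemma exceed_pmf_ge0 m r t : 0 <= t -> 0 <= exceed_pmf m r t.
Proof.
move=> t0; elim: m r => [|m IH] r //=.
apply: addr_ge0; apply: mulr_ge0; rewrite ?expR_ge0//.
  by rewrite subr_ge0 expR_le1 oppr_le0.
by case: r => [|r]; [exact: lexx|exact: IH].
Qed.

Lemma measurable_exceed_pmf m r : measurable_fun setT (exceed_pmf m r : V -> V).
Proof.
have me : measurable_fun setT (fun t : V => expR (- t) : V).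
  exact: measurableT_comp.
elim: m r => [|m IH] r /=; first exact: measurable_cst.
apply: measurable_funD; apply: measurable_funM => //.
- exact: measurable_funB.
- exact: IH.
- by case: r => [|r]; [exact: measurable_cst|exact: IH].
Qed.

Lemma measurable_gap_step : measurable_fun setT gap_step.
Proof.
have m1 : measurable_fun setT (fun p : gap_state * V => p.1.1.1).
  exact: (measurableT_comp measurable_fst (measurableT_comp measurable_fst measurable_fst)).
have mN : measurable_fun setT (fun p : gap_state * V => p.1.1.2).
  exact: (measurableT_comp measurable_snd (measurableT_comp measurable_fst measurable_fst)).
have mS : measurable_fun setT (fun p : gap_state * V => p.1.2).
  exact: (measurableT_comp measurable_snd measurable_fst).
have mlt : measurable_fun setT (fun p : gap_state * V => (p.1.1.1 < p.2)%R).
  by apply: measurable_fun_ltr.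
apply: measurable_fun_pair; first apply: measurable_fun_pair => //.
  rewrite (_ : (fun p : gap_state * V => _) =
    (fun p => if p.1.1.1 < p.2 then p.1.1.2.+1 else p.1.1.2)%R); last first.
    by apply/funext => p; case: ifP; rewrite ?addn1 ?addn0.
  apply: measurable_fun_ifT => //.
  exact: (measurableT_comp (f := S)).
apply: measurable_funD => //; apply: measurable_funM => //.
  exact: (measurableT_comp (f := fun b : bool => b%:R : R)).
exact: measurable_funB.
Qed.

Lemma measurable_gap_value m k c : measurable_fun setT (gap_value m k c).
Proof.
apply: measurable_sum => r; apply: measurable_funM.
  apply: (measurableT_comp (f := fun n => (n + r == k)%N%:R : R)) => //.
  exact: (measurableT_comp measurable_snd measurable_fst).
apply: measurable_funM.
  apply: measurableT_comp; first exact: measurable_exceed_pmf.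
  exact: (measurableT_comp measurable_fst measurable_fst).
apply: measurableT_comp; first exact: measurable_gamma_cdf.
exact: measurable_funB.
Qed.

Lemma gap_value_ge0 m k c z : 0 <= z.1.1 -> 0 <= gap_value m k c z.
Proof.
move=> z0; apply: sumr_ge0 => r _.
by rewrite !mulr_ge0// ?exceed_pmf_ge0// gamma_cdf_ge0.
Qed.

(** A score at or below the level leaves the state unchanged, while one above it yields precisely
    the integrands to which lack of memory applies. *)
Lemma gap_value_step m k c z x :
  gap_value m k c (gap_step (z, x)) =
  gap_value m k c z * (x <= z.1.1)%R%:R +
  \sum_(r < k.+1) (z.1.2.+1 + r == k)%N%:R * exceed_pmf m r z.1.1 *
    ((z.1.1 < x)%R%:R * gamma_cdf r (c - z.2 - (x - z.1.1))).
Proof.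
rewrite /gap_value /=; case: ltP => [zx|xz].
  rewrite mulr0 add0r; apply: eq_bigr => r _.
  by rewrite !mul1r mulrA addn1 opprD addrA.
rewrite mulr1 [X in _ = _ + X]big1 ?addr0; last by move=> r _; rewrite mul0r mulr0.
by apply: eq_bigr => r _; rewrite addn0 mul0r addr0.
Qed.

(** Pascal's rule for [exceed_pmf], reindexed so that its second part matches the integral over the
    scores above the level. *)
Lemma gap_valueS m k c z :
  gap_value m.+1 k c z =
  (1 - expR (- z.1.1)) * gap_value m k c z +
  \sum_(r < k.+1) (z.1.2.+1 + r == k)%N%:R * exceed_pmf m r z.1.1 *
    (expR (- z.1.1) * gamma_cdf r.+1 (c - z.2)).
Proof.
rewrite /gap_value mulr_sumr /=.
under eq_bigr => r _ do rewrite mulrDl mulrDr.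
rewrite big_split/=; congr (_ + _).
  by apply: eq_bigr => r _; rewrite -mulrA mulrCA.
(* The term [r = 0] has no predecessor in Pascal's rule, and the last term of the shifted sum is
   zero since a count already increased by one cannot gain [k] more and end at [k]. *)
rewrite big_ord_recl/= mulr0 mul0r mulr0 add0r [RHS]big_ord_recr/=.
rewrite [X in _ = _ + X](_ : _ = 0) ?addr0; last first.
  by rewrite gtn_eqF ?mul0r//= addSn ltnS leq_addl.
apply: eq_bigr => r _; rewrite /bump/= add1n addnS addSn.
by rewrite -!mulrA; congr (_ * _); rewrite mulrCA.
Qed.

(** This is a backward equation: the next score stays below the level with probability
    [1 - expR (- z.1.1)], and otherwise lack of memory adds one to the Gamma shape. Together these
    are the recursion [gap_valueS]. *)
Lemma integral_gap_step (mu : probability V R) m k c z :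
  (forall A, measurable A -> mu A = exponential_prob 1 A) -> 0 <= z.1.1 ->
  (\int[mu]_x (gap_value m k c (gap_step (z, x)))%:E =
   (gap_value m.+1 k c z)%:E)%E.
Proof.
move=> muE z0.
under eq_integral do rewrite gap_value_step EFinD.
have mshift (r : nat) : measurable_fun setT
    (fun x : V => (z.1.1 < x)%R%:R * gamma_cdf r (c - z.2 - (x - z.1.1))).
  apply: measurable_funM.
    apply: (measurableT_comp (f := fun b : bool => b%:R : R)) => //.
    exact: measurable_fun_ltr.
  apply: measurableT_comp; first exact: measurable_gamma_cdf.
  by apply: measurable_funB => //; exact: measurable_funB.
have mle : measurable_fun setT (fun x : V => (x <= z.1.1)%R%:R : R).
  apply: (measurableT_comp (f := fun b : bool => b%:R : R)) => //.
  exact: measurable_fun_ler.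
have shift0 (r : nat) x : 0 <= (z.1.1 < x)%R%:R * gamma_cdf r (c - z.2 - (x - z.1.1)).
  by rewrite mulr_ge0// gamma_cdf_ge0.
have coef0 (r : nat) : 0 <= (z.1.2.+1 + r == k)%N%:R * exceed_pmf m r z.1.1.
  by rewrite mulr_ge0// exceed_pmf_ge0.
have gv0 := gap_value_ge0 m k c z0.
rewrite ge0_integralD//=; last 4 first.
- by move=> x _; rewrite lee_fin mulr_ge0.
- by apply/measurable_EFinP; exact: measurable_funM.
- by move=> x _; rewrite lee_fin sumr_ge0// => r _; rewrite mulr_ge0.
- apply/measurable_EFinP; apply: measurable_sum => r.
  exact: measurable_funM.
rewrite gap_valueS EFinD; congr (_ + _)%E.
  under eq_integral do rewrite EFinM.
  rewrite ge0_integralZl//=; last exact/measurable_EFinP.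
  rewrite mulrC EFinM; congr (_ * _)%E.
  rewrite (_ : (fun x : V => ((x <= z.1.1)%R%:R)%:E) =
    EFin \o \1_(`]-oo, z.1.1]%classic : set V)).
    rewrite integral_indic// setIT.
    transitivity (exponential_prob 1 (`]-oo, z.1.1]%classic : set R)); first exact: muE.
    rewrite exponential_prob_itvNyc gamma_cdf_ge0E//.
    by rewrite poisson_ccdfS poisson_ccdf0 /poisson_term expr0 fact0 divr1 mulr1.
  by apply/funext => x /=; rewrite indicE mem_setE in_itv.
rewrite -sumEFin.
under eq_integral do rewrite -sumEFin.
rewrite ge0_integral_sum//=; last 2 first.
- by move=> r; apply/measurable_EFinP; exact: measurable_funM.
- by move=> r x _; rewrite lee_fin mulr_ge0.
apply: eq_bigr => r _.
under eq_integral do rewrite EFinM.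
rewrite ge0_integralZl//=; last 3 first.
- by apply/measurable_EFinP; exact: mshift.
- by move=> x _; rewrite lee_fin shift0.
- by rewrite lee_fin coef0.
rewrite [RHS]EFinM; congr (_ * _)%E; exact: integral_exponential_shift.
Qed.

End gap_statistic.

(** * Number and total excess of independent exponential scores above one of them *)

Section iid_gaps.
Context d (T : measurableType d) (R : realType) (P : probability T R).
Local Notation V := (measurableTypeR R).
Context (E : nat -> T -> V).

Definition exceed_count (s : seq nat) (t : R) (w : T) : nat :=
  count (fun i => (t < E i w)%R) s.

Definition exceed_sum (s : seq nat) (t : R) (w : T) : R :=
  \sum_(i <- s) (t < E i w)%R%:R * (E i w - t).

Definition gap_fold (Z : T -> gap_state) (s : seq nat) (w : T) : gap_state :=
  foldl (fun z i => gap_step (z, E i w)) (Z w) s.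

Lemma gap_foldE Z s w : gap_fold Z s w =
  ((Z w).1.1, ((Z w).1.2 + exceed_count s (Z w).1.1 w)%N,
   (Z w).2 + exceed_sum s (Z w).1.1 w).
Proof.
rewrite /gap_fold /exceed_sum; move: (Z w) => z.
elim: s z => [|i s IH] z /=; first by rewrite big_nil addr0 addn0; case: z => [[]].
by rewrite IH/= big_cons addnA addrA.
Qed.

Hypothesis mE : forall i, measurable_fun setT (E i).
Hypothesis E_indep : indep_family P E.
Hypothesis E_law : forall i B, measurable B -> P (E i @^-1` B) = exponential_prob 1 B.
Hypothesis E_ge0 : forall i w, 0 <= E i w.

Let nu : probability V R := std_exponential.

(** By induction on [s], the first score is absorbed into the starting state, the induction
    hypothesis integrates out the others, and the backward equation then integrates out the
    first. *)
Lemma integral_gap_fold (D s : seq nat) (Z : T -> gap_state) m k c :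
  measurable_fun setT Z -> indep_outside P E D Z -> uniq s ->
  ~~ has (mem D) s -> (forall w, 0 <= (Z w).1.1) ->
  (\int[P]_w (gap_value m k c (gap_fold Z s w))%:E =
   \int[P]_w (gap_value (m + size s) k c (Z w))%:E)%E.
Proof.
elim: s D Z => [|i s IH] D Z mZ Zi /=; first by rewrite addn0.
move=> /andP[iNs us]; rewrite negb_or => /andP[iND sND] Z0.
rewrite (IH (i :: D) (fun w => gap_step (Z w, E i w)))//; first last.
- apply/hasP => -[j js]; rewrite /= inE => /orP[/eqP ji|jD].
    by rewrite -ji js in iNs.
  by move/hasP : sND; apply; exists j.
- by apply: (indep_outside_step mE E_indep mZ Zi iND measurable_gap_step).
- by apply: (measurableT_comp measurable_gap_step); exact: measurable_fun_pair.
(* Tonelli needs a function that is nonnegative everywhere, whereas [gap_value] is known to be so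
   only at nonnegative levels; along [Z] the absolute value changes nothing. *)
pose g (p : gap_state * V) := `|gap_value (m + size s) k c (gap_step p)|%:E.
have gE w x : g (Z w, x) = (gap_value (m + size s) k c (gap_step (Z w, x)))%:E.
  by rewrite /g ger0_norm//; apply: gap_value_ge0; exact: Z0.
transitivity (\int[P]_w g (Z w, E i w))%E.
  by apply: eq_integral => w _; rewrite gE.
rewrite (@indep_outside_integral _ _ _ _ _ _ _ _ _ _ D _ _ _ _ _ nu)//.
- apply: eq_integral => w _; rewrite addnS -(@integral_gap_step _ nu)//.
  by apply: eq_integral => y _; rewrite gE.
- by move=> B mB; rewrite E_law.
- apply/measurable_EFinP; apply: measurableT_comp => //.
  by apply: measurableT_comp; [exact: measurable_gap_value|exact: measurable_gap_step].
- by move=> p; rewrite /g lee_fin.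
Qed.

Lemma measurable_gap_fold Z s :
  measurable_fun setT Z -> measurable_fun setT (gap_fold Z s).
Proof.
elim: s Z => [//|i s IH] Z mZ; apply: (IH (fun w => gap_step (Z w, E i w))).
by apply: (measurableT_comp measurable_gap_step); exact: measurable_fun_pair.
Qed.

(** With no score left only [r = 0] contributes, and shape 0, being the Dirac mass at 0, turns the
    value into an indicator. *)
Lemma gap_value0 k c z :
  gap_value 0 k c z = ((z.1.2 == k) && (z.2 <= c))%:R :> R.
Proof.
rewrite /gap_value big_ord_recl/= addn0 big1 ?addr0; last first.
  by move=> r _; rewrite /= mul0r mulr0.
rewrite mul1r /gamma_cdf subr_lt0 poisson_ccdf0 ltNge.
by case: eqP => _; case: leP; rewrite /= ?mul1r ?mul0r.
Qed.

Lemma gap_value_start m k c t :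
  gap_value m k c (t, 0%N, 0) = exceed_pmf m k t * gamma_cdf k c :> R.
Proof.
rewrite /gap_value big_ord_recr/= add0n eqxx mul1r subr0 big1 ?add0r// => r _.
by rewrite add0n ltn_eqF ?mul0r.
Qed.

Lemma measurable_exceed (j : nat) (s : seq nat) k c : measurable
  [set w | exceed_count s (E j w) w = k /\ exceed_sum s (E j w) w <= c].
Proof.
pose Z w : gap_state := (E j w, 0%N, 0).
have mZ : measurable_fun setT Z.
  by apply: measurable_fun_pair => //; exact: measurable_fun_pair.
have mg : measurable_fun setT (gap_value 0 k c \o gap_fold Z s).
  apply: (measurableT_comp (measurable_gap_value _ _ _)).
  exact: measurable_gap_fold.
rewrite (_ : mkset _ = (gap_value 0 k c \o gap_fold Z s) @^-1` [set 1%R]).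
  by rewrite -[X in measurable X]setTI; exact: mg.
apply/seteqP; split => w; rewrite /= gap_value0 gap_foldE/= !add0n !add0r.
  by move=> [-> ->]; rewrite eqxx.
by case: eqP => //=; case: (_ <= _) => //= _ /eqP; rewrite eq_sym oner_eq0.
Qed.

(** From the state with level [E j], count 0 and sum 0 the value factorises: the level enters only
    through the binomial probability and [c] only through the Gamma distribution function. *)
Lemma prob_exceed (j : nat) (s : seq nat) k c : uniq s -> j \notin s ->
  (P [set w | exceed_count s (E j w) w = k /\ (exceed_sum s (E j w) w <= c)%R] =
   (gamma_cdf k c)%:E * \int[P]_w (exceed_pmf (size s) k (E j w))%:E)%E.
Proof.
move=> us jNs; pose Z w : gap_state := (E j w, 0%N, 0).
have mZ : measurable_fun setT Z.
  by apply: measurable_fun_pair => //; exact: measurable_fun_pair.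
have Zi : indep_outside P E [:: j] Z.
  move=> s' A B us' s'D mA mB.
  pose h (x : V) : gap_state := (x, 0%N, 0).
  have -> : Z @^-1` B = E j @^-1` (h @^-1` B) by [].
  apply: indep_outside_self => //.
  rewrite -[X in measurable X]setTI.
  have mh : measurable_fun setT h.
    by apply: measurable_fun_pair => //; exact: measurable_fun_pair.
  exact: mh.
have := @integral_gap_fold [:: j] s Z 0 k c mZ Zi us _ (fun w => E_ge0 j w).
rewrite add0n => /(_ _) H.
transitivity (\int[P]_w (gap_value 0 k c (gap_fold Z s w))%:E)%E.
  have mA := measurable_exceed j s k c.
  rewrite -[X in P X]setIT -integral_indic//; apply: eq_integral => w _.
  rewrite gap_value0 gap_foldE/= indicE add0n add0r; congr ((nat_of_bool _)%:R%:E).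
  apply/idP/idP; rewrite inE/=; first by move=> [-> ->]; rewrite eqxx.
  by move=> /andP[/eqP].
rewrite H; last first.
  by apply/hasP => -[i si]; rewrite /= inE => /eqP ij; rewrite -ij si in jNs.
under eq_integral do rewrite gap_value_start mulrC EFinM.
rewrite ge0_integralZl//.
- apply/measurable_EFinP.
  exact: (measurableT_comp (measurable_exceed_pmf _ _) (mE j)).
- by move=> w _; rewrite lee_fin exceed_pmf_ge0.
- by rewrite lee_fin gamma_cdf_ge0.
Qed.

End iid_gaps.

(** * The law of the tail statistic *)

Section order_gaps.
Context {R : realType}.
Implicit Types (s u : seq R) (t c : R) (k p n : nat).

Definition count_above u t : nat := count (fun x => t < x)%R u.

Definition sum_above u t : R := \sum_(x <- u) (t < x)%R%:R * (x - t).

Lemma sorted_count_above s p : sorted <%R s -> (p < size s)%N ->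
  count_above s (nth 0 s p) = (size s - p.+1)%N.
Proof.
move=> ss ps; rewrite /count_above -sum1_count big_mkcond (big_nth 0)/=.
rewrite (big_cat_nat _ (n := p.+1))//= big1_seq ?add0n; last first.
  move=> i /=; rewrite mem_index_iota ltnS => /andP[_ ip].
  by rewrite lt_sorted_ltn_nth// ?inE ?(leq_ltn_trans ip)// ltnNge ip.
rewrite (eq_big_nat _ _ (F2 := fun=> 1%N)) ?sum_nat_const_nat ?muln1//.
by move=> i /andP[pi ins]; rewrite lt_sorted_ltn_nth ?inE// pi.
Qed.

Lemma sorted_sum_above s p : sorted <%R s -> (p < size s)%N ->
  sum_above s (nth 0 s p) = \sum_(p.+1 <= i < size s) (nth 0 s i - nth 0 s p).
Proof.
move=> ss ps; rewrite /sum_above (big_nth 0)/=.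
rewrite (big_cat_nat _ (n := p.+1))//= big1_seq ?add0r; last first.
  move=> i /=; rewrite mem_index_iota ltnS => /andP[_ ip].
  by rewrite lt_sorted_ltn_nth// ?inE ?(leq_ltn_trans ip)// ltnNge ip mul0r.
apply: eq_big_nat => i /andP[pi ins].
by rewrite lt_sorted_ltn_nth ?inE// pi mul1r.
Qed.

(** In a strictly increasing list exactly one entry has [k] entries above it, so the sum has a
    single term that can be nonzero. *)
Lemma sum_count_above u s k c :
  uniq u -> perm_eq u s -> sorted <%R s -> (k < size s)%N ->
  (\sum_(x <- u) ((count_above u x == k) && (sum_above u x <= c)%R) =
   (\sum_(size s - k <= i < size s)
      (nth 0 s i - nth 0 s (size s - k).-1) <= c)%R :> nat)%N.
Proof.
move=> uu us ss ks.
have -> : count_above u = count_above s.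
  by apply/funext => t; apply/permP.
have -> : sum_above u = sum_above s by apply/funext => t; exact: perm_big.
rewrite (perm_big _ us)/= (big_nth 0).
(* Positions count from 0, so the order statistic of rank [size s - k] sits at [(size s - k).-1]. *)
have pk : ((size s - k).-1 < size s)%N by lia.
have pk1 : (size s - k).-1.+1 = (size s - k)%N by lia.
rewrite (bigD1_seq (size s - k).-1) ?mem_index_iota ?iota_uniq//=.
rewrite sorted_count_above// sorted_sum_above// pk1.
rewrite [X in (X == k)](_ : _ = k) ?eqxx; last lia.
rewrite [X in (_ + X)%N]big1_seq ?addn0// => i /andP[ik].
rewrite mem_index_iota => /andP[_ ins].
rewrite sorted_count_above//; case: eqP => //= h; exfalso; move/eqP : ik; apply.
lia.
Qed.

End order_gaps.

Section tail_stat_gaps.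
Context d (T : measurableType d) (R : realType) (P : probability T R).
Context (F : cumulativeBounded (0 : R) (1 : R)) (X : nat -> {RV P >-> R}).

Definition exp_score (i : nat) (w : T) : R := - ln (1 - F (X i w)).

(** The map from observations to scores preserves order, so the ordered scores are the scores of the
    order statistics and [k] times the statistic is the sum of the top [k] excesses. *)
Lemma tail_stat_le (k n : nat) (r : R) (w : T) : (1 <= k < n)%N ->
  (forall i, (i < n)%N -> F (X i w) < 1) ->
  uniq (mkseq (exp_score ^~ w) n) ->
  (tail_stat F X k n w <= r)%R =
  (\sum_(x <- mkseq (exp_score ^~ w) n)
     ((count_above (mkseq (exp_score ^~ w) n) x == k) &&
      (sum_above (mkseq (exp_score ^~ w) n) x <= k%:R * r)%R))%N :> nat.
Proof.
move=> /andP[k1 kn] F1 ue.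
pose L x : R := - ln (1 - F x).
pose x := sort <=%R (mkseq (X ^~ w) n).
pose s := map L x.
have ss : size s = n by rewrite size_map size_sort size_mkseq.
have exs : perm_eq (mkseq (exp_score ^~ w) n) s.
  rewrite perm_sym (_ : mkseq _ _ = map L (mkseq (X ^~ w) n)).
    by apply: perm_map; rewrite perm_sort.
  by rewrite /mkseq -map_comp.
have sos : sorted <%R s.
  rewrite lt_sorted_uniq_le -(perm_uniq exs) ue/=.
  (* Monotonicity is claimed only where [F y < 1]: at [F y = 1] the default value of [ln] would send
     the score back to 0. *)
  apply: (@homo_sorted_in _ _ (fun y => F y < 1)%R _ <=%R).
  - move=> a b Fa Fb ab; rewrite /L lerN2 ler_ln ?posrE ?subr_gt0//.
    by rewrite lerB//; apply: cumulative_is_nondecreasing.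
  - apply/allP => y; rewrite mem_sort => /mapP[i].
    rewrite mem_iota add0n => /andP[_ ilt] ->.
    exact: F1.
  - by apply: sort_sorted; exact: le_total.
rewrite (sum_count_above _ ue exs sos) ss//; congr nat_of_bool.
have nthL i : (i < n)%N -> nth 0 s i = L (nth 0 x i).
  by move=> ilt; rewrite (nth_map 0)// -(size_map L) ss.
(* Ranks [n - k + 1] to [n] become positions [n - k] to [n - 1]; the [k] copies of the baseline
   cancel the factor [k%:R^-1]. *)
have -> : tail_stat F X k n w =
    k%:R^-1 * \sum_(n - k <= i < n) (nth 0 s i - nth 0 s (n - k).-1).
  rewrite sumrB sumr_const_nat subKn ?(ltnW kn)// mulrBr.
  rewrite -[X in _ - _ * X]mulr_natl mulKf ?pnatr_eq0 -?lt0n//.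
  rewrite nthL; last lia.
  rewrite /tail_stat /L addn1 big_add1/= addrC; congr (_ + _); last first.
    by rewrite opprK.
  rewrite -mulrN -sumrN; congr (_ * _); apply: eq_big_nat => i /andP[_ ilt].
  by rewrite nthL.
by rewrite mulrC ler_pdivrMr ?ltr0n// [r * _]mulrC.
Qed.

End tail_stat_gaps.

(** * Exponential scores of the sample and the exact law of the tail statistic *)

Section tail_stat_law.
Context d (T : measurableType d) (R : realType) (P : probability T R).
Context (F : cumulativeBounded (0 : R) (1 : R)) (X : nat -> {RV P >-> R}).
Hypothesis F_cont : continuous F.
Hypothesis X_indep : mutually_independent X.
Hypothesis X_cdf : forall (i : nat) (x : R), cdf (X i) x = (F x)%:E.
Local Notation V := (measurableTypeR R).
Local Notation E := (exp_score F X : nat -> T -> V).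

Let F_nd : {homo F : x y / x <= y}.
Proof. exact: cumulative_is_nondecreasing. Qed.

Let mF : measurable_fun setT F.
Proof. by apply: nondecreasing_measurable => //; exact: F_nd. Qed.

Lemma cumulative01 x : 0 <= F x <= 1.
Proof.
rewrite -!lee_fin -!(X_cdf 0) cdf_ge0/=.
exact: (cdf_le1 (X 0)).
Qed.

Lemma cumulative_surj u : 0 < u < 1 -> exists x, F x = u.
Proof.
move=> /andP[u0 u1].
have /cvgrPdist_lt/(_ _ u0) := cumulativeNy F => -[a [_ aP]].
have /cvgrPdist_lt/(_ (1 - u)) := cumulativey F; rewrite subr_gt0 => /(_ u1) [b [_ bP]].
have Fa : F (a - 1) < u.
  have := aP (a - 1); rewrite ltrBlDr ltrDl ltr01 => /(_ isT).
  by rewrite sub0r normrN ger0_norm//; have /andP[] := cumulative01 (a - 1).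
have Fb : u < F (b + 1).
  have := bP (b + 1); rewrite ltrDl ltr01 => /(_ isT).
  by rewrite ger0_norm ?ltrD2l ?ltrN2 ?subr_ge0//; have /andP[] := cumulative01 (b + 1).
have ab : a - 1 <= b + 1.
  rewrite leNgt; apply/negP => ba.
  have := F_nd (ltW ba).
  by rewrite leNgt (lt_trans Fa Fb).
have [||x _ <-] := @IVT R F (a - 1) (b + 1) u ab; last by exists x.
  exact: continuous_subspaceT.
by rewrite ge_min le_max (ltW Fa) (ltW Fb) orbT.
Qed.

Let mFX i : measurable_fun setT (fun w => F (X i w)).
Proof. exact: measurableT_comp. Qed.

Lemma measurable_cumulative_le i u : measurable [set w | F (X i w) <= u].
Proof.
rewrite (_ : mkset _ = (fun w => F (X i w)) @^-1` `]-oo, u]).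
  by rewrite -[X in measurable X]setTI; exact: mFX.
by apply/seteqP; split => w /=; rewrite in_itv.
Qed.

Lemma measurable_cumulative_ge i u : measurable [set w | u <= F (X i w)].
Proof.
rewrite (_ : mkset _ = (fun w => F (X i w)) @^-1` `[u, +oo[).
  by rewrite -[X in measurable X]setTI; exact: mFX.
by apply/seteqP; split => w /=; rewrite in_itv/= andbT.
Qed.

(** Since [F] may be flat, the event is compared with rays instead of being identified with one.
    Continuity supplies the endpoints of the rays through the intermediate value theorem. *)
Lemma probability_integral_transform i u : 0 <= u < 1 ->
  P [set w | F (X i w) <= u] = u%:E.
Proof.
move=> /andP[u0 u1].
have mu := measurable_cumulative_le i u.
have mX x : measurable (X i @^-1` `]-oo, x]) by exact: measurable_funPTI.
apply/eqP; rewrite eq_le; apply/andP; split.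
  (* An endpoint with [F x = u + e] lies beyond the flat piece at height [u], so its ray contains
     the event. *)
  apply/lee_addgt0Pr => e e0.
  have [eu|ue] := leP 1 (u + e).
    by rewrite (le_trans (probability_le1 _ _)).
  have [x Fx] : exists x, F x = u + e.
    by apply: cumulative_surj; rewrite ue andbT ltr_wpDl.
  rewrite -EFinD -Fx -(X_cdf i) /cdf /distribution /pushforward.
  apply: le_measure; rewrite ?inE// => w /= h; rewrite in_itv/= leNgt; apply/negP => xX.
  have := le_trans (F_nd (ltW xX)) h.
  by rewrite Fx leNgt ltrDl e0.
(* The value 0 may fail to be attained by [F], but there the lower bound is trivial. *)
have [->|un0] := eqVneq u 0; first by [].
have [x Fx] : exists x, F x = u by apply: cumulative_surj; rewrite lt_neqAle eq_sym un0 u0.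
rewrite -[in leLHS]Fx -(X_cdf i) /cdf /distribution /pushforward.
apply: le_measure; rewrite ?inE// => w /=; rewrite in_itv/= => Xx.
by rewrite -Fx; exact: F_nd.
Qed.

Lemma prob_cumulative_ge1 i : P [set w | 1 <= F (X i w)] = 0%E.
Proof.
have mge := measurable_cumulative_ge i 1.
apply/eqP; rewrite eq_le measure_ge0 andbT; apply/lee_addgt0Pr => e e0.
rewrite add0e; have [e1|e1] := leP 1 e.
  by rewrite (le_trans (probability_le1 _ _)).
have -> : e%:E = P (~` [set w | F (X i w) <= 1 - e]).
  rewrite probability_setC ?probability_integral_transform.
  - by rewrite -EFinB opprB addrC subrK.
  - by rewrite subr_ge0 (ltW e1)/= ltrBlDr ltrDl.
  - exact: measurable_cumulative_le.
apply: le_measure; rewrite ?inE//.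
  by apply: measurableC; exact: measurable_cumulative_le.
move=> w /= h; apply/negP; rewrite -ltNge (lt_le_trans _ h)//.
by rewrite ltrBlDr ltrDl.
Qed.

Lemma exp_score_ge0 i w : 0 <= E i w.
Proof.
rewrite oppr_ge0 ln_le0// lerBlDr lerDl.
by have /andP[] := cumulative01 (X i w).
Qed.

Lemma measurable_exp_score i : measurable_fun setT (E i).
Proof.
apply: measurableT_comp => //; apply: measurableT_comp => //.
by apply: measurable_funB => //; exact: measurableT_comp.
Qed.

Lemma exp_score_law i B : measurable B -> P (E i @^-1` B) = exponential_prob 1 B.
Proof.
pose E' : {mfun T >-> V} := HB.pack (E i)
  (isMeasurableFun.Build _ _ _ _ _ (measurable_exp_score i)).
apply: (@exponential_prob_cdf _ (distribution P E')) => x.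
transitivity (P (E i @^-1` `]-oo, x]%classic)); first by [].
rewrite /gamma_cdf; case: ltP => x0.
  rewrite (_ : _ @^-1` _ = set0) ?measure0//.
  apply/seteqP; split => // w /=; rewrite in_itv/= leNgt (lt_le_trans x0)//.
  exact: exp_score_ge0.
rewrite poisson_ccdfS poisson_ccdf0 /poisson_term expr0 fact0 divr1 mulr1.
rewrite -(@probability_integral_transform i); last first.
  by rewrite subr_ge0 expR_le1 oppr_le0 x0 ltrBlDr ltrDl expR_gt0.
(* On the null event [F (X i) = 1] the default [ln 0 = 0] makes the score 0, hence at most [x]; the
   event must be added for the two sets to coincide. *)
rewrite -[RHS](measureU0 (measurable_cumulative_le _ _)
  (measurable_cumulative_ge i 1) (prob_cumulative_ge1 i)).
congr (P _); apply/seteqP; split => w /=; rewrite in_itv/= /exp_score lerNl.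
  have [F1|F1] := ltP (F (X i w)) 1; last by right.
  rewrite -ler_expR lnK ?posrE ?subr_gt0// => h; left.
  by rewrite lerBrDr addrC -lerBrDr.
have [F1|F1] := ltP (F (X i w)) 1.
  move=> [h|//].
  by rewrite -ler_expR lnK ?posrE ?subr_gt0// lerBrDr addrC -lerBrDr.
by move=> _; rewrite ln0 ?oppr_le0// subr_le0.
Qed.

Lemma exp_score_indep : indep_family P E.
Proof.
move=> s A us mA.
pose L x : V := - ln (1 - F x).
have mL : measurable_fun setT (L : R -> V).
  apply: measurableT_comp => //; apply: measurableT_comp => //.
  exact: measurable_funB.
have mLA i : measurable (L @^-1` A i : set R).
  by rewrite -[X in measurable X]setTI; exact: mL.
have ps : perm_eq s [fset i in s]%fset.
  by apply: uniq_perm => [//||i]; [exact: fset_uniq|rewrite inE].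
have := X_indep [fset i in s]%fset mLA.
rewrite -bigsetI_fset_set; last exact: finite_fset.
rewrite set_fsetK.
have -> : cylinder E s A =
    \big[setI/setT]_(i <- [fset i in s]%fset) X i @^-1` (L @^-1` A i).
  exact: perm_big.
by move=> ->; apply/esym; exact: perm_big.
Qed.

(** For fixed [E i], integrating out the independent score [E j] leaves the exponential mass of a
    single point, which is 0. *)
Lemma ae_exp_score_neq i j : i != j -> {ae P, forall w, E i w <> E j w}.
Proof.
move=> ij; have mE := measurable_exp_score.
have meq : measurable [set w | E i w = E j w].
  rewrite (_ : mkset _ = (fun w => E i w == E j w) @^-1` [set true]).
    by rewrite -[X in measurable X]setTI; apply: (measurable_fun_eqr (mE i) (mE j)).
  by apply/seteqP; split => w /= /eqP.
exists [set w | E i w = E j w]; split => //; last by move=> w /= /contrapT.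
pose g (p : V * V) : \bar R := (p.1 == p.2)%:R%:E.
have mg : measurable_fun setT g.
  apply/measurable_EFinP.
  apply: (measurableT_comp (f := fun b : bool => b%:R : R)) => //.
  exact: measurable_fun_eqr.
pose nu : probability V R := std_exponential.
transitivity (\int[P]_w g (E i w, E j w))%E.
  rewrite -[X in P X]setIT -integral_indic//; apply: eq_integral => w _.
  rewrite indicE /g; congr ((nat_of_bool _)%:R%:E).
  by apply/idP/eqP; rewrite inE.
rewrite (@indep_outside_integral _ _ _ _ _ _ _ _ _ _ [:: i] _ _ _ _ _ nu)//.
- apply: integral0_eq => w _.
  transitivity (nu [set E i w]).
    rewrite -[X in nu X]setIT -integral_indic//; apply: eq_integral => y _.
    rewrite indicE /g; congr ((nat_of_bool _)%:R%:E).
    by apply/eqP/idP; rewrite inE/=.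
  by rewrite /nu/= /exponential_prob integral_set1.
- by apply: indep_outside_self => //; exact: exp_score_indep.
- by rewrite inE eq_sym.
- by move=> B mB; rewrite exp_score_law.
- by move=> p; rewrite /g lee_fin.
Qed.

(** Each choice of the score serving as baseline contributes the same function of [r], so the
    distribution function is known up to one constant; nothing combinatorial has to be evaluated. *)
Lemma tail_stat_prob (k n : nat) : (1 <= k < n)%N ->
  exists C : \bar R, forall r,
    P [set w | tail_stat F X k n w <= r] = ((gamma_cdf k (k%:R * r))%:E * C)%E.
Proof.
move=> kn.
pose others j := rem j (iota 0 n).
exists (\sum_(j < n) \int[P]_w (exceed_pmf (size (others j)) k (E j w))%:E)%E => r.
have mE := measurable_exp_score.
pose A j := [set w | exceed_count E (others j) (E j w) w = k /\
  exceed_sum E (others j) (E j w) w <= k%:R * r].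
have mA j : measurable (A j) by apply: measurable_exceed.
have mB : measurable [set w | tail_stat F X k n w <= r].
  rewrite (_ : mkset _ = tail_stat F X k n @^-1` `]-oo, r]).
    by apply: measurable_funPTI.
  by apply/seteqP; split => w /=; rewrite in_itv.
transitivity (\sum_(j < n) P (A j))%E; last first.
  rewrite ge0_sume_distrr; last first.
    by move=> j _; apply: integral_ge0 => w _; rewrite lee_fin exceed_pmf_ge0// exp_score_ge0.
  apply: eq_bigr => j _; apply: prob_exceed => //.
  - exact: exp_score_indep.
  - exact: exp_score_law.
  - exact: exp_score_ge0.
  - by rewrite rem_uniq ?iota_uniq.
  - by rewrite mem_rem_uniq ?iota_uniq// inE eqxx.
transitivity (\int[P]_w (\sum_(j < n) (\1_(A j) w)%:E))%E; last first.
  rewrite ge0_integral_sum//.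
    by apply: eq_bigr => j _; rewrite integral_indic// setIT.
  by move=> j; apply/measurable_EFinP.
(* Off a null set there are no ties and all [F (X i)] are below 1; there the indicator of the event
   is the sum of the indicators of the [A j]. *)
rewrite -[X in P X]setIT -integral_indic//.
apply: ge0_ae_eq_integral => //.
- by apply/measurable_EFinP.
- by apply: emeasurable_sum => j; apply/measurable_EFinP.
- by move=> w _; apply: sume_ge0 => j _; rewrite lee_fin.
have h1 : {ae P, forall w, forall i, F (X i w) < 1}.
  apply: ae_foralln => i; exists [set w | 1 <= F (X i w)]; split.
  - exact: measurable_cumulative_ge.
  - exact: prob_cumulative_ge1.
  - by move=> w /= /negP; rewrite -leNgt.
have h2 : {ae P, forall w, forall i j, i != j -> E i w <> E j w}.
  apply: ae_foralln => i; apply: ae_foralln => j.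
  have [ij|ij] := eqVneq i j; first by apply: aeW.
  by apply: filterS (ae_exp_score_neq ij) => w.
apply: filterS2 h1 h2 => w F1 neqE _.
rewrite sumEFin; congr EFin.
under eq_bigr do rewrite indicE.
rewrite indicE -natr_sum; congr (_%:R).
have -> : (w \in [set w | tail_stat F X k n w <= r]) = (tail_stat F X k n w <= r).
  by apply/idP/idP; rewrite inE.
rewrite tail_stat_le//; last first.
  rewrite mkseq_uniq// => i j /eqP Eij; apply/eqP; apply: contraTT Eij => ij.
  by apply/eqP; exact: neqE.
rewrite big_map -[X in iota _ X]subn0 big_mkord; apply: eq_bigr => j _.
have jn : (j : nat) \in iota 0 n by rewrite mem_iota/=.
(* Comparison is strict, so [E j] neither counts as above itself nor adds an excess, and dropping
   [j] from the indices is harmless. *)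
have -> : count_above (mkseq (E ^~ w) n) (E j w) = exceed_count E (others j) (E j w) w.
  by rewrite /count_above /exceed_count count_map count_rem jn/= ltxx subn0.
have -> : sum_above (mkseq (E ^~ w) n) (E j w) = exceed_sum E (others j) (E j w) w.
  by rewrite /sum_above /exceed_sum big_map (big_rem (j : nat))//= ltxx mul0r add0r.
congr nat_of_bool; apply/idP/idP; rewrite inE /A/=; first by move=> /andP[/eqP].
by move=> [/eqP -> ->].
Qed.

(** The constant is found by letting [r] tend to infinity, where both the distribution function of
    the statistic and that of the Gamma law tend to 1. *)
Lemma tail_stat_cdf (k n : nat) r : (1 <= k < n)%N ->
  P [set w | tail_stat F X k n w <= r] = (gamma_cdf k (k%:R * r))%:E.
Proof.
move=> kn; have [C PC] := tail_stat_prob kn.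
suff C1 : C = 1%E by rewrite PC C1 mule1.
have k0 : 0 < k%:R :> R by rewrite ltr0n; case/andP: kn.
have c1 := @cvg_cdfy1 _ _ _ P [the {mfun T >-> R} of tail_stat F X k n].
have c2 : cdf [the {RV P >-> R} of tail_stat F X k n] @ +oo%R --> (1 * C)%E.
  rewrite (_ : cdf _ = fun s => ((gamma_cdf k (k%:R * s))%:E * C)%E); last first.
    apply/funext => s; rewrite -PC /cdf /distribution /pushforward.
    by congr (P _).
  (* At this point [C] could still be infinite; the product of limits is defined all the same
     because the other limit is 1, not 0. *)
  apply: cvgeM; [|rewrite /=|exact: cvg_cst].
    have [Cfin|Coo] := boolP (C \is a fin_num); first exact: mule_def_fin.
    by apply: mule_def_neq0_infty.
  apply: cvg_EFin; first exact: nearW.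
  have c3 : poisson_ccdf k (k%:R * s) @[s --> +oo] --> (1 : R).
    apply: (@cvg_comp _ _ _ (fun s : R => k%:R * s) (poisson_ccdf k) _ (pinfty_nbhs R)).
      exact: gt0_cvgMry.
    exact: cvg_poisson_ccdf.
  apply: cvg_trans c3; apply: near_eq_cvg; near=> s.
  by rewrite /= gamma_cdf_ge0E// mulr_ge0// ltW.
by rewrite mul1e in c2; apply: cvg_unique c2 c1.
Unshelve. all: by end_near. Qed.

End tail_stat_law.

(** * Normal approximation of the Gamma distribution *)

Section ln_bounds.
Context {R : realType}.
Implicit Types s u : R.

(* [ln y <= y - 1] at [y = sqrt (1 + s)]. *)
Lemma ln1D_le s : - 1 < s -> ln (1 + s) - s <= - (s ^+ 2 / (4 + 2 * `|s|)).
Proof.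
move=> s1; have s0 : 0 < 1 + s by rewrite -ltrBlDl sub0r.
pose q := Num.sqrt (1 + s).
have q0 : 0 < q by rewrite sqrtr_gt0.
have q2 : q ^+ 2 = 1 + s by rewrite sqr_sqrtr// ltW.
have lnq : ln (1 + s) <= 2 * (q - 1).
  have -> : ln (1 + s) = 2 * ln q by rewrite -q2 lnXn// mulr_natl.
  rewrite ler_pM2l//.
  by have := @le_ln1Dx R (q - 1); rewrite [1 + _]addrC subrK; apply; rewrite ltrBrDl subrr.
have sE : s = (q - 1) * (q + 1) by rewrite -subr_sqr q2 expr1n; ring.
have -> : s ^+ 2 / (4 + 2 * `|s|) = (q - 1) ^+ 2 * ((q + 1) ^+ 2 / (4 + 2 * `|s|)).
  by rewrite {1}sE exprMn mulrA.
have d0 : 0 < 4 + 2 * `|s| by rewrite ltr_wpDr// mulr_ge0.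
(* Indeed (q + 1)^2 + (q - 1)^2 = 2 (q^2 + 1) = 4 + 2 s. *)
have : (q + 1) ^+ 2 / (4 + 2 * `|s|) <= 1.
  rewrite ler_pdivrMr// mul1r.
  have := ler_norm s; have := sqr_ge0 (q - 1).
  by rewrite sqrrB1 sqrrD1 q2; lra.
move=> /(ler_wpM2l (sqr_ge0 (q - 1))); rewrite mulr1.
have : ln (1 + s) - s <= - (q - 1) ^+ 2.
  have : s = q ^+ 2 - 1 by rewrite q2; ring.
  by rewrite sqrrB1; lra.
lra.
Qed.

(** The remainder vanishes at 0 and has derivative x^2 / (1 + x), so the mean value theorem bounds
    it; the factor 2 comes from 1 + c being at least 1/2. *)
Lemma ln1D_taylor2 s : `|s| <= 2^-1 ->
  `|ln (1 + s) - s + s ^+ 2 / 2| <= 2 * `|s| ^+ 3.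
Proof.
move=> s12.
pose f x : R := ln (1 + x) - x + x ^+ 2 / 2.
have f0 : f 0 = 0 by rewrite /f addr0 ln1 expr0n/= mul0r !addr0 subrr.
have df (x : R) : - 1 < x -> is_derive x 1 f (x ^+ 2 / (1 + x)).
  move=> x1; have x0 : 0 < 1 + x by rewrite -ltrBlDl sub0r.
  have d1 : is_derive x 1 (fun x : R => 1 + x) 1.
    rewrite (_ : (fun x : R => 1 + x) = cst 1 + id); last by apply/funext.
    by apply: is_derive_eq; rewrite add0r.
  have d2 := is_derive1_comp (is_derive1_ln x0) d1.
  have -> : f = (@ln R \o (fun x => 1 + x)) - id + 2^-1 \*: (@id R ^+ 2).
    by apply/funext => y; rewrite /f !fctE/= [_ *: _]mulrC.
  apply: is_derive_eq; rewrite /GRing.scale/= expr1.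
  by field; rewrite gt_eqF.
have cf (x : R) : - 1 < x -> {for x, continuous f}.
  move=> x1; have dfx := df x x1.
  by apply: differentiable_continuous; apply/derivable1_diffP; exact: ex_derive.
have key c : `|c| <= `|s| -> `|c ^+ 2 / (1 + c)| <= 2 * `|s| ^+ 2.
  move=> cs; have c12 := le_trans cs s12.
  have c1 : 2^-1 <= 1 + c by have := ler_norm (- c); rewrite normrN; lra.
  rewrite normrM normrX mulrC; apply: ler_pM => //.
    rewrite ger0_norm ?invr_ge0; last lra.
    by rewrite invf_ple ?posrE//; lra.
  by rewrite lerXn2r ?nnegrE.
have goal c : `|c| <= `|s| -> f s = c ^+ 2 / (1 + c) * s -> `|f s| <= 2 * `|s| ^+ 3.
  by move=> cs ->; rewrite normrM (exprSr `|s| 2) mulrA ler_wpM2r// key.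
have sN := ler_norm s; have sNN := ler_norm (- s); rewrite normrN in sNN.
have [s0|s0] := leP 0 s.
- have [||c] := @MVT_segment R f (fun c => c ^+ 2 / (1 + c)) 0 s s0.
  + by move=> x; rewrite in_itv/= => /andP[x0 _]; apply: df; lra.
  + apply: continuous_in_subspaceT => x; rewrite inE/= in_itv/= => /andP[x0 _].
    by apply: cf; lra.
  rewrite in_itv/= f0 !subr0 => /andP[c0 cs]; apply: goal.
  by rewrite !ger0_norm.
- have [||c] := @MVT_segment R f (fun c => c ^+ 2 / (1 + c)) s 0 (ltW s0).
  + by move=> x; rewrite in_itv/= => /andP[x0 _]; apply: df; lra.
  + apply: continuous_in_subspaceT => x; rewrite inE/= in_itv/= => /andP[x0 _].
    by apply: cf; lra.
  rewrite in_itv/= f0 !sub0r mulrN => /andP[sc c0] /oppr_inj; apply: goal.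
  by rewrite !ler0_norm ?lerN2// ltW.
Qed.

End ln_bounds.

(** * Pointwise limit, domination and normalisation of the rescaled Gamma densities *)

Section gamma_clt.
Context {R : realType}.
Implicit Types (u x : R) (n : nat).

(* The shape is [n.+2] rather than [n] because the bound [clt_exponent_le] needs a
   shape of at least 2. *)
Definition clt_scale n : R := Num.sqrt n.+2%:R.

(** Logarithm of the ratio of the Gamma density of shape [n.+2] at [n.+2%:R + clt_scale n * u] to
    its value at [n.+2%:R]. *)
Definition clt_exponent n u : R :=
  n.+1%:R * ln (1 + u / clt_scale n) - clt_scale n * u.

(* Density of [(Gamma(k) - k) / sqrt k] for [k = n.+2], up to the factor
   [amplitude n] below. *)
Definition clt_density n u : R :=
  if - clt_scale n < u then expR (clt_exponent n u) else 0.

Lemma clt_scale_ge1 n : 1 <= clt_scale n.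
Proof. by rewrite -[leLHS]sqrtr1 ler_wsqrtr// ler1n. Qed.

Lemma clt_scale_gt0 n : 0 < clt_scale n.
Proof. exact: lt_le_trans (clt_scale_ge1 n). Qed.

Lemma clt_scale_sqr n : clt_scale n ^+ 2 = n.+2%:R.
Proof. by rewrite sqr_sqrtr. Qed.

(** The density carries the power [n.+1] while the linear term amounts to [n.+2] copies of
    [u / clt_scale n]; pairing them off leaves one copy over. *)
Lemma clt_exponentE n u : clt_exponent n u =
  n.+1%:R * (ln (1 + u / clt_scale n) - u / clt_scale n) - u / clt_scale n.
Proof.
have a0 := clt_scale_gt0 n; have a2 := clt_scale_sqr n.
rewrite /clt_exponent mulrBr -addrA -opprD; congr (_ - _).
rewrite -[X in _ + X]mul1r -mulrDl natr1 -a2.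
by field; rewrite gt_eqF.
Qed.

Lemma clt_exponent_le n u : - clt_scale n < u ->
  clt_exponent n u <= 3 / 2 - `|u| / 4.
Proof.
move=> au; have a0 := clt_scale_gt0 n; have a1 := clt_scale_ge1 n.
rewrite clt_exponentE; move sE : (u / clt_scale n) => s.
have s1 : - 1 < s by rewrite -sE ltr_pdivlMr// mulN1r.
have su : `|s| <= `|u|.
  rewrite -sE normrM [X in _ * X]ger0_norm; last by rewrite invr_ge0 ltW.
  by rewrite ler_piMr // invf_le1.
have us : u ^+ 2 = n.+2%:R * s ^+ 2.
  by rewrite -clt_scale_sqr -sE; field; rewrite gt_eqF.
have h1 : n.+1%:R * (ln (1 + s) - s) <= - (n.+1%:R * s ^+ 2 / (4 + 2 * `|s|)).
  by rewrite -mulrA -mulrN; apply: ler_wpM2l => //; exact: ln1D_le.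
(* This amounts to [n.+2 <= 2 * n.+1], which is where the shape must be at least 2. *)
have h2 : u ^+ 2 / 2 <= n.+1%:R * s ^+ 2.
  rewrite us -[n.+2%:R]natr1 -[n.+1%:R]natr1.
  have n0 : 0 <= n%:R :> R by [].
  have := sqr_ge0 s; nra.
have u0 := normr_ge0 u; have s0 := normr_ge0 s.
(* After clearing denominators this is (|u| - 2) (|u| + 2) <= u^2. *)
have h3 : (`|u| - 2) / 4 <= u ^+ 2 / 2 / (4 + 2 * `|u|).
  rewrite ler_pdivlMr; last lra.
  rewrite -[u ^+ 2]real_normK ?num_real//; nra.
have h4 : u ^+ 2 / 2 / (4 + 2 * `|u|) <= n.+1%:R * s ^+ 2 / (4 + 2 * `|s|).
  apply: ler_pM => //.
  - by rewrite divr_ge0// sqr_ge0.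
  - by rewrite lef_pV2 ?posrE; lra.
(* The leftover [- s] is less than 1, and [h3] gives away another 1/2; their sum is the constant
   3/2. *)
lra.
Qed.

Lemma cvg_clt_scaleV : (clt_scale n)^-1 @[n --> \oo] --> (0 : R).
Proof.
have -> : (fun n => (clt_scale n)^-1) = (fun n => Num.sqrt (n.+2%:R^-1 : R)).
  by apply/funext => n; rewrite sqrtrV.
rewrite -sqrtr0; apply: (cvg_comp _ (@Num.sqrt R)); last exact: sqrt_continuous.
have := @cvg_harmonic R; rewrite -(cvg_shiftS (harmonic : R^nat)).
exact.
Qed.

(** With s = u / sqrt k and k = n + 2, the error is k (ln (1 + s) - s + s^2 / 2) - ln (1 + s). As k
    s^2 = u^2, its first part is at most 2 u^2 |s|, which vanishes with s. *)
Lemma cvg_clt_exponent u : clt_exponent n u @[n --> \oo] --> - (u ^+ 2 / 2).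
Proof.
pose s n := u / clt_scale n.
have s0 : s n @[n --> \oo] --> (0 : R).
  by rewrite -(mulr0 u); apply: cvgM; [exact: cvg_cst|exact: cvg_clt_scaleV].
have s1 : 1 + s n @[n --> \oo] --> (1 : R).
  by rewrite -[X in _ --> X]addr0; apply: cvgD => //; exact: cvg_cst.
have ln0 : ln (1 + s n) @[n --> \oo] --> (0 : R).
  by rewrite -(@ln1 R); apply: (continuous_cvg _ (continuous_ln ltr01) s1).
have sn0 : `|s n| @[n --> \oo] --> (0 : R) by rewrite -(@normr0 _ R); exact: cvg_norm.
apply/subr_cvg0; apply: norm_cvg0.
apply: (@squeeze_cvgr _ _ _ _ (fun=> 0) (fun n => 2 * u ^+ 2 * `|s n| + `|ln (1 + s n)|)).
- near=> n; rewrite normr_ge0/=.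
  have s12 : `|s n| <= 2^-1 by near: n; apply: cvgr_le sn0 _ _.
  have a0 := clt_scale_gt0 n.
  have us : u ^+ 2 = n.+2%:R * s n ^+ 2.
    by rewrite -clt_scale_sqr /s; field; rewrite gt_eqF.
  have -> : clt_exponent n u - - (u ^+ 2 / 2) =
      n.+2%:R * (ln (1 + s n) - s n + s n ^+ 2 / 2) - ln (1 + s n).
    by rewrite clt_exponentE us -/(s n) -[n.+2%:R]natr1; ring.
  rewrite (le_trans (ler_normB _ _))// lerD2r normrM ger0_norm//.
  have -> : 2 * u ^+ 2 * `|s n| = n.+2%:R * (2 * `|s n| ^+ 3).
    by rewrite us -[s n ^+ 2]real_normK ?num_real//; ring.
  by rewrite ler_wpM2l// ln1D_taylor2.
- exact: cvg_cst.
- rewrite -[X in _ --> X]addr0; apply: cvgD; last first.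
    by rewrite -(@normr0 _ R); exact: cvg_norm.
  by rewrite -(mulr0 (2 * u ^+ 2)); apply: cvgM => //; exact: cvg_cst.
Unshelve. all: by end_near. Qed.

Lemma measurable_clt_density n : measurable_fun setT (clt_density n).
Proof.
apply: measurable_fun_ifT => //; first exact: measurable_fun_ltr.
apply: measurableT_comp => //; apply: measurable_funB; last exact: measurable_funM.
apply: measurable_funM => //; apply: measurableT_comp => //.
by apply: measurable_funD => //; exact: measurable_funM.
Qed.

Lemma cvg_clt_density u : clt_density n u @[n --> \oo] --> expR (- (u ^+ 2 / 2)).
Proof.
have h : expR (clt_exponent n u) @[n --> \oo] --> expR (- (u ^+ 2 / 2)).
  have ce : {for (- (u ^+ 2 / 2)), continuous (@expR R)} by exact: continuous_expR.
  exact: (continuous_cvg _ ce (@cvg_clt_exponent u)).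
apply: cvg_trans h; apply: near_eq_cvg; near=> n.
(* The cut-off at [- clt_scale n] recedes to minus infinity, so a fixed [u] eventually lies in the
   support. *)
rewrite /clt_density ifT// ltrNl -[X in _ < X]mul1r -ltr_pdivrMr ?clt_scale_gt0//.
near: n; apply: (@cvgr_lt _ _ _ _ _ 0); last exact: ltr01.
by rewrite -(mulr0 (- u)); apply: cvgM; [exact: cvg_cst|exact: cvg_clt_scaleV].
Unshelve. all: by end_near. Qed.

Lemma clt_density_ge0 n u : 0 <= clt_density n u.
Proof. by rewrite /clt_density; case: ifP => // _; exact: expR_ge0. Qed.

Lemma clt_density_le n u : clt_density n u <= expR (3 / 2 - `|u| / 4).
Proof.
rewrite /clt_density; case: ifP => [au|_]; last exact: expR_ge0.
by rewrite ler_expR clt_exponent_le.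
Qed.

Lemma integrable_clt_bound : lebesgue_measure.-integrable setT
  (fun u : R => (expR (3 / 2 - `|u| / 4))%:E).
Proof.
have cb : continuous (fun u : R => expR (3 / 2 - `|u| / 4)).
  move=> u; apply: (@continuous_comp _ _ _ (fun u : R => 3 / 2 - `|u| / 4) expR).
    apply: cvgB; first exact: cvg_cst.
    by apply: cvgM; [exact: norm_continuous|exact: cvg_cst].
  exact: continuous_expR.
have mb : measurable_fun setT (fun u : R => expR (3 / 2 - `|u| / 4)).
  exact: continuous_measurable_fun.
have dF (u : R) : is_derive u 1 (fun u : R => - (4 * expR (3 / 2 - u / 4)))
    (expR (3 / 2 - u / 4)).
  have d1 : is_derive u 1 (fun u : R => 3 / 2 - u / 4) (- 4^-1).
    rewrite (_ : (fun _ => _) = cst (3 / 2) - (4^-1 \*: @id R)).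
      by apply: is_derive_eq; rewrite sub0r [_ *: _]mulr1.
    by apply/funext => x; rewrite !fctE/= [_ *: _]mulrC.
  have d2 := is_derive1_comp (is_derive_expR _) d1.
  rewrite (_ : (fun _ => _) = - (4 \*: (@expR R \o (fun u : R => 3 / 2 - u / 4)))).
    by apply: is_derive_eq; rewrite /GRing.scale/=; field.
  by apply/funext.
apply/integrableP; split; first exact/measurable_EFinP.
under eq_integral do rewrite /= ger0_norm ?expR_ge0//.
rewrite ge0_symfun_integralT//=; last by move=> u; rewrite /= normrN.
rewrite -[X in integral _ X]set_itvcy.
rewrite (@ge0_continuous_FTC2y R _ (fun u => - (4 * expR (3 / 2 - u / 4))) 0 0).
- by rewrite -EFinB -EFinM ltry.
- by move=> u _; exact: expR_ge0.
- exact: continuous_subspaceT.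
- rewrite -oppr0; apply: cvgN; rewrite -(mulr0 (4 * expR (3 / 2))).
  rewrite (_ : (fun _ => _) =
    (fun u => 4 * expR (3 / 2) * expR (- (4^-1 * u)))); last first.
    by apply/funext => u; rewrite expRD mulrA [u / 4]mulrC.
  apply: cvgM; first exact: cvg_cst.
  apply: (@cvg_comp _ _ _ (fun u : R => 4^-1 * u) (fun u => expR (- u)) _
    (pinfty_nbhs R)); last exact: cvgr_expR.
  by apply: gt0_cvgMry.
- by move=> u _; have du := dF u; exact: ex_derive.
- have cF : {for (0 : R), continuous (fun u : R => - (4 * expR (3 / 2 - u / 4)))}.
    have du := dF 0.
    by apply: differentiable_continuous; apply/derivable1_diffP; exact: ex_derive.
  exact: cvg_at_right_filter cF.
- move=> u; rewrite in_itv/= andbT => u0; rewrite derive1E.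
  by have du := dF u; rewrite derive_val ger0_norm// ltW.
Qed.

(** Density at 0 of the standardised Gamma variable of shape [n.+2]; Stirling's formula would give
    its limit. *)
Let amplitude n : R := clt_scale n * (expR (- n.+2%:R) * (n.+2%:R ^+ n.+1 / n.+1`!%:R)).

Let amplitude_gt0 n : 0 < amplitude n.
Proof.
by rewrite !mulr_gt0 ?clt_scale_gt0 ?expR_gt0 ?invr_gt0 ?exprn_gt0 ?ltr0n ?fact_gt0.
Qed.

Lemma clt_densityE n u : - clt_scale n < u ->
  amplitude n * clt_density n u =
  poisson_term n.+1 (n.+2%:R + clt_scale n * u) * clt_scale n.
Proof.
move=> au; rewrite /clt_density au /clt_exponent /amplitude /poisson_term.
have a0 := clt_scale_gt0 n.
have e1 : expR (- (n.+2%:R + clt_scale n * u)) =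
    expR (- n.+2%:R) * expR (- (clt_scale n * u)).
  by rewrite opprD expRD.
have e2 : (n.+2%:R + clt_scale n * u) ^+ n.+1 =
    n.+2%:R ^+ n.+1 * (1 + u / clt_scale n) ^+ n.+1.
  rewrite -exprMn; congr (_ ^+ _).
  by rewrite -clt_scale_sqr; field; rewrite gt_eqF.
rewrite e1 e2 expRB expRM_natl lnK -?expRN; last first.
  by rewrite posrE -ltrBlDl sub0r ltr_pdivlMr// mulN1r.
by ring.
Qed.

Lemma is_derive_gamma_rescaled n u :
  is_derive u 1 (fun u => poisson_ccdf n.+2 (n.+2%:R + clt_scale n * u))
    (poisson_term n.+1 (n.+2%:R + clt_scale n * u) * clt_scale n).
Proof.
apply: (@is_derive1_comp _ (poisson_ccdf n.+2) (fun u => n.+2%:R + clt_scale n * u)).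
  exact: is_derive_poisson_ccdf.
rewrite (_ : (fun _ => _) = cst n.+2%:R + clt_scale n \*: @id R); last by apply/funext.
by apply: is_derive_eq; rewrite add0r [_ *: _]mulr1.
Qed.

Lemma continuous_gamma_density n :
  continuous (fun u => poisson_term n.+1 (n.+2%:R + clt_scale n * u) * clt_scale n).
Proof.
move=> u; apply: cvgM; last exact: cvg_cst.
apply: (@continuous_comp _ _ _ (fun u => n.+2%:R + clt_scale n * u) (poisson_term n.+1)).
  by apply: cvgD; [exact: cvg_cst|apply: cvgM; [exact: cvg_cst|exact: cvg_id]].
have dp := @is_derive_poisson_termS R n (n.+2%:R + clt_scale n * u).
by apply: differentiable_continuous; apply/derivable1_diffP; exact: ex_derive.
Qed.

Lemma measurable_gamma_density n D : measurable_fun D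
  (fun u => (poisson_term n.+1 (n.+2%:R + clt_scale n * u) * clt_scale n)%:E).
Proof.
apply: measurable_funTS; apply/measurable_EFinP.
by apply: continuous_measurable_fun; exact: continuous_gamma_density.
Qed.

Lemma continuous_gamma_rescaled n :
  continuous (fun u => poisson_ccdf n.+2 (n.+2%:R + clt_scale n * u)).
Proof.
move=> u; have du := is_derive_gamma_rescaled n u.
by apply: differentiable_continuous; apply/derivable1_diffP; exact: ex_derive.
Qed.

Lemma gamma_density_ge0 n u : - clt_scale n <= u ->
  0 <= poisson_term n.+1 (n.+2%:R + clt_scale n * u) * clt_scale n.
Proof.
move=> au; have a0 := clt_scale_gt0 n.
apply: mulr_ge0; last exact: ltW; apply: poisson_term_ge0.
rewrite -clt_scale_sqr expr2 -mulrDr mulr_ge0 ?(ltW a0)//.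
by rewrite -lerBlDl sub0r.
Qed.

(** The rescaled [poisson_ccdf] is an antiderivative of the true density, so the fundamental theorem
    of calculus replaces a change of variables. *)
Lemma integral_clt_density_itv n x :
  ((amplitude n)%:E * \int[lebesgue_measure]_(u in `]-oo, x]) (clt_density n u)%:E =
   (gamma_cdf n.+2 (n.+2%:R + clt_scale n * x))%:E)%E.
Proof.
have a0 := clt_scale_gt0 n.
have k0 : n.+2%:R + clt_scale n * - clt_scale n = 0.
  by rewrite -clt_scale_sqr; ring.
rewrite -ge0_integralZl//; last 3 first.
- by apply: measurable_funTS; apply/measurable_EFinP; exact: measurable_clt_density.
- by move=> u _; rewrite lee_fin clt_density_ge0.
- by rewrite lee_fin ltW.
have [xa|ax] := leP x (- clt_scale n).
  rewrite integral0_eq => [|u]; last first.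
    rewrite /= in_itv/= => ux.
    by rewrite /clt_density ifF ?mule0//; apply/negbTE; rewrite -leNgt (le_trans ux).
  (* Below the support [gamma_cdf] is 0 by its cut-off; the remaining case is the boundary point,
     where its argument is exactly 0. *)
  rewrite /gamma_cdf; case: ltP => // h.
  suff -> : n.+2%:R + clt_scale n * x = 0 by rewrite poisson_ccdfS0.
  apply/eqP; rewrite eq_le h andbT -[leRHS]k0 lerD2l.
  by apply: ler_wpM2l => //; exact: ltW.
rewrite gamma_cdf_ge0E; last first.
  by rewrite -k0 lerD2l; apply: ler_wpM2l; apply: ltW.
transitivity (\int[lebesgue_measure]_(u in `](- clt_scale n)%R, x])
    (poisson_term n.+1 (n.+2%:R + clt_scale n * u) * clt_scale n)%:E)%E.
  rewrite [LHS]integral_mkcond [RHS]integral_mkcond; apply: eq_integral => u _.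
  rewrite !patchE !mem_setE !in_itv/=; have [au|ua] := ltP (- clt_scale n) u.
    by rewrite -EFinM clt_densityE.
  by rewrite /clt_density ltNge ua mule0/= if_same.
rewrite integral_itv_obnd_cbnd; last exact: measurable_gamma_density.
rewrite (@continuous_FTC2 R _ (fun u => poisson_ccdf n.+2 (n.+2%:R + clt_scale n * u)))//.
- by rewrite k0 poisson_ccdfS0 sube0.
- by apply: continuous_subspaceT; exact: continuous_gamma_density.
- split => [u _||].
  + by have du := is_derive_gamma_rescaled n u; exact: ex_derive.
  + by apply: cvg_at_right_filter; exact: continuous_gamma_rescaled.
  + by apply: cvg_at_left_filter; exact: continuous_gamma_rescaled.
- by move=> u _; have du := is_derive_gamma_rescaled n u; rewrite derive1E derive_val.
Qed.

Lemma integral_clt_density n :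
  ((amplitude n)%:E * \int[lebesgue_measure]_u (clt_density n u)%:E = 1)%E.
Proof.
have a0 := clt_scale_gt0 n.
rewrite -ge0_integralZl//; last 3 first.
- by apply/measurable_EFinP; exact: measurable_clt_density.
- by move=> u _; rewrite lee_fin clt_density_ge0.
- by rewrite lee_fin ltW.
transitivity (\int[lebesgue_measure]_(u in `](- clt_scale n)%R, +oo[)
    (poisson_term n.+1 (n.+2%:R + clt_scale n * u) * clt_scale n)%:E)%E.
  rewrite [RHS]integral_mkcond; apply: eq_integral => u _.
  rewrite patchE mem_setE in_itv/= andbT; have [au|ua] := ltP (- clt_scale n) u.
    by rewrite -EFinM clt_densityE.
  by rewrite /clt_density ltNge ua mule0.
rewrite integral_itv_obnd_cbnd; last exact: measurable_gamma_density.
rewrite (@ge0_continuous_FTC2y R _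
  (fun u => poisson_ccdf n.+2 (n.+2%:R + clt_scale n * u)) _ 1)//.
- rewrite (_ : n.+2%:R + clt_scale n * - clt_scale n = 0); last first.
    by rewrite -clt_scale_sqr; ring.
  by rewrite poisson_ccdfS0 sube0.
- by move=> u; exact: gamma_density_ge0.
- by apply: continuous_subspaceT; exact: continuous_gamma_density.
- apply: (@cvg_comp _ _ _ (fun u => n.+2%:R + clt_scale n * u) (poisson_ccdf n.+2)
    _ (pinfty_nbhs R)).
    apply: (@cvg_comp _ _ _ (fun u => clt_scale n * u) (fun y => n.+2%:R + y)
      _ (pinfty_nbhs R)).
      exact: gt0_cvgMry.
    exact: cvg_addrl.
  exact: cvg_poisson_ccdf.
- by move=> u _; have du := is_derive_gamma_rescaled n u; exact: ex_derive.
- by apply: cvg_at_right_filter; exact: continuous_gamma_rescaled.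
- by move=> u _; have du := is_derive_gamma_rescaled n u; rewrite derive1E derive_val.
Qed.

Let gauss u : R := expR (- (u ^+ 2 / 2)).

Let integrable_clt_density n D : measurable D ->
  lebesgue_measure.-integrable D (fun u => (clt_density n u)%:E).
Proof.
move=> mD; apply: (@le_integrable _ _ _ _ D mD _ (fun u => (expR (3 / 2 - `|u| / 4))%:E)).
- by apply: measurable_funTS; apply/measurable_EFinP; exact: measurable_clt_density.
- move=> u _ /=; rewrite lee_fin ger0_norm ?clt_density_ge0// ger0_norm ?expR_ge0//.
  exact: clt_density_le.
- by apply: (integrableS _ _ (@subsetT _ D)) => //; exact: integrable_clt_bound.
Qed.

(** Dominated convergence, stated for a general [D] because both a half-line and the whole line are
    needed for the quotient of integrals. *)
Lemma cvg_integral_clt_density D : measurable D ->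
  lebesgue_measure.-integrable D (fun u => (gauss u)%:E) /\
  (\int[lebesgue_measure]_(u in D) (clt_density n u)%:E @[n --> \oo] -->
   \int[lebesgue_measure]_(u in D) (gauss u)%:E)%E.
Proof.
move=> mD.
have [] := @dominated_convergence _ _ R lebesgue_measure D mD
  (fun n u => (clt_density n u)%:E) (fun u => (gauss u)%:E)
  (fun u => (expR (3 / 2 - `|u| / 4))%:E).
- by move=> n; apply: measurable_funTS; apply/measurable_EFinP; exact: measurable_clt_density.
- apply: measurable_funTS; apply/measurable_EFinP; apply: measurableT_comp => //.
  by apply: measurableT_comp => //; exact: measurable_funM.
- apply: aeW => u _; apply: cvg_EFin; first by apply: nearW.
  exact: cvg_clt_density.
- by apply: (integrableS _ _ (@subsetT _ D)) => //; exact: integrable_clt_bound.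
- apply: aeW => u n _; rewrite /= lee_fin ger0_norm ?clt_density_ge0//.
  exact: clt_density_le.
by [].
Qed.

Lemma normal_prob_gauss D : measurable D ->
  normal_prob 0 1 D =
  ((normal_peak 1)%:E * \int[lebesgue_measure]_(u in D) (gauss u)%:E)%E.
Proof.
move=> mD; have [ig _] := cvg_integral_clt_density mD.
rewrite /normal_prob -integralZl//; apply: eq_integral => u _.
rewrite normal_pdfE ?oner_neq0// /normal_fun subr0 expr1n.
by rewrite -EFinM mulNr.
Qed.

(** The Gamma distribution function is a half-line integral over the total one, which cancels
    [amplitude]. Both integrals converge, and the constant of the normal density is likewise the
    inverse of the total Gaussian integral. *)
Lemma gamma_cdf_clt x :
  (gamma_cdf n.+2 (n.+2%:R + clt_scale n * x))%:E @[n --> \oo] -->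
  normal_prob 0 1 `]-oo, x]%classic.
Proof.
have mD : measurable (`]-oo, x]%classic : set (measurableTypeR R)) by [].
have mT := @measurableT _ (measurableTypeR R).
have [igD cD] := cvg_integral_clt_density mD.
have [igT cT] := cvg_integral_clt_density mT.
pose I n D := fine (\int[lebesgue_measure]_(u in D) (clt_density n u)%:E)%E.
pose J D := fine (\int[lebesgue_measure]_(u in D) (gauss u)%:E)%E.
have IE n D : measurable D ->
    (\int[lebesgue_measure]_(u in D) (clt_density n u)%:E)%E = (I n D)%:E.
  move=> mE; rewrite /I fineK//; apply: (integrable_fin_num mE).
  by apply: integrable_clt_density.
have JE D : measurable D -> lebesgue_measure.-integrable D (fun u => (gauss u)%:E) ->
    (\int[lebesgue_measure]_(u in D) (gauss u)%:E)%E = (J D)%:E.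
  by move=> mE iD; rewrite /J fineK//; apply: (integrable_fin_num mE).
have IJ D : measurable D -> lebesgue_measure.-integrable D (fun u => (gauss u)%:E) ->
    (\int[lebesgue_measure]_(u in D) (clt_density n u)%:E @[n --> \oo] -->
     \int[lebesgue_measure]_(u in D) (gauss u)%:E)%E ->
    I n D @[n --> \oo] --> J D.
  by move=> mE iD cv; apply: fine_cvg; rewrite -JE.
have ratio n : gamma_cdf n.+2 (n.+2%:R + clt_scale n * x) =
    I n `]-oo, x]%classic / I n setT.
  have := integral_clt_density_itv n x; have := integral_clt_density n.
  rewrite !IE// -!EFinM => -[h1] -[<-].
  have IT0 : I n setT != 0.
    by apply: contra_eq_neq h1 => ->; rewrite mulr0 eq_sym oner_neq0.
  have -> : amplitude n = (I n setT)^-1 by rewrite -[RHS]mul1r -h1 mulfK.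
  by rewrite mulrC.
have peakJ : normal_peak 1 * J setT = 1.
  apply: EFin_inj; rewrite EFinM -JE// -normal_prob_gauss//.
  by rewrite /normal_prob integral_normal_pdf.
have JT0 : J setT != 0.
  by apply: contra_eq_neq peakJ => ->; rewrite mulr0 eq_sym oner_neq0.
rewrite normal_prob_gauss// JE// -EFinM.
have -> : normal_peak 1 = (J setT)^-1 by apply: (mulIf JT0); rewrite peakJ mulVf.
have h : gamma_cdf n.+2 (n.+2%:R + clt_scale n * x) @[n --> \oo] -->
    J `]-oo, x]%classic / J setT.
  rewrite (_ : (fun n => _) = (fun n => I n `]-oo, x]%classic / I n setT)).
    by apply: cvgM; [exact: IJ|apply: cvgV => //; exact: IJ].
  by apply/funext => n; rewrite ratio.
by rewrite mulrC; apply: cvg_EFin; [exact: nearW|exact: h].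
Qed.

End gamma_clt.

(** * Transfer of the Gamma limit to the tail statistic *)

Theorem theorem1 (R : realType)
    (F0 : cumulativeBounded (0 : R) (1 : R)) (F0_cont : continuous F0)
    (d : measure_display) (T : measurableType d) (P : probability T R)
    (X : nat -> {RV P >-> R})
    (X_indep : mutually_independent X)
    (X_cdf : forall (i : nat) (x : R), cdf (X i) x = (F0 x)%:E)
    (d' : measure_display) (T' : measurableType d') (Q : probability T' R)
    (xi : {RV Q >-> R})
    (xi_normal : forall A : set R, measurable A ->
      distribution Q xi A = normal_prob 0 1 A)
    (k n : nat -> nat)
    (kn : forall m : nat, (1 <= k m < n m)%N)
    (k_oo : k m @[m --> \oo] --> \oo)
    (n_oo : n m @[m --> \oo] --> \oo) :
  cvg_in_distribution
    (fun m => Num.sqrt (k m)%:R *: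
      ([the {mfun T >-> R} of tail_stat F0 X (k m) (n m)] - 1)
      : {RV P >-> R})
    xi.

Proof.
move=> x _.
have -> : cdf xi x = normal_prob 0 1 `]-oo, x]%classic by rewrite /cdf xi_normal.
(* The Gamma limit is indexed so that [n] stands for shape [n.+2]; composing it with [(k m).-2]
   gives shape [k m] once [k m] is at least 2. *)
have k2_oo : (k m).-2 @[m --> \oo] --> \oo.
  apply/cvgnyPge => N; near=> m.
  have : (N.+2 <= k m)%N by near: m; move/cvgnyPge : k_oo; apply.
  by case: (k m) => [|[]].
have h := cvg_comp _ _ k2_oo (@gamma_cdf_clt R x).
apply: cvg_trans h; apply: near_eq_cvg; near=> m.
have k2 : (2 <= k m)%N by near: m; move/cvgnyPge : k_oo; apply.
have kE : (k m).-2.+2 = k m by case: (k m) k2 => [|[]].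
rewrite /= /clt_scale kE.
have a0 : 0 < Num.sqrt (k m)%:R :> R by rewrite sqrtr_gt0 ltr0n (leq_trans _ k2).
(* The standardised statistic is at most [x] exactly when the statistic is at most
   [1 + x / Num.sqrt (k m)%:R]; multiplying this threshold by [k m] gives the Gamma argument. *)
have -> : (k m)%:R + Num.sqrt (k m)%:R * x = (k m)%:R * (1 + x / Num.sqrt (k m)%:R).
  rewrite -[X in X + _ = X * _](@sqr_sqrtr R)//; field; exact: lt0r_neq0.
rewrite -(tail_stat_cdf F0_cont X_indep X_cdf _ (kn m)).
rewrite /cdf /distribution /pushforward/=; congr (P _).
apply/funext => w; apply/propext; rewrite /= in_itv/=.
change ((tail_stat F0 X (k m) (n m) w <= 1 + x / Num.sqrt (k m)%:R) <->
  (Num.sqrt (k m)%:R * (tail_stat F0 X (k m) (n m) w - 1) <= x)).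
by rewrite -lerBlDl ler_pdivlMr// mulrC.
Unshelve. all: by end_near. Qed.
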